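(* For every closed connected orientable surface $\Sigma$ there exist a Riemannian metric on $\Sigma$, a Tonelli Lagrangian $L:T\Sigma\to\mathbb R$ and intersecting non-empty closed connected submanifolds $Q_0,Q_1\subseteq\Sigma$ such that, for every connected component $\Omega$ of $Q_0\cap Q_1$, $$k(L;Q_0,Q_1)<k_\Omega<c(L;Q_0,Q_1)$$ and there are no connecting orbits having energy $k<k_\Omega$.
   Context: Let $M=\Sigma$. A Tonelli Lagrangian is a smooth function $L:TM\to\mathbb R$ that is fiberwise $C^2$-strictly convex ($d_{vv}L>0$) and fiberwise superlinear. Energy: $E(q,v)=d_vL(q,v)\cdot v-L(q,v)$, constant along Euler-Lagrange orbits. A connecting orbit is an Euler-Lagrange orbit $\gamma:[0,R]\to M$, $R>0$, with $\gamma(0)\in Q_0$, $\gamma(R)\in Q_1$, $d_vL(\gamma(0),\dot\gamma(0))|_{T_{\gamma(0)}Q_0}=0$, $d_vL(\gamma(R),\dot\gamma(R))|_{T_{\gamma(R)}Q_1}=0$. Let $H(q,p)=\max_{v\in T_qM}[\langle p,v\rangle-L(q,v)]$ and let $N^*Q_i=\{(q,p)\in T^*M\mid q\in Q_i,\ T_qQ_i\subseteq\ker p\}$ be the conormal bundle. Then $k(L;Q_0,Q_1):=\inf\{k\in\mathbb R\mid H^{-1}(k)\cap N^*Q_i\ne\emptyset\text{ for }i=0,1\}$. Let $G<\pi_1(M)$ be the smallest normal subgroup containing the images of $\pi_1(Q_0)$ and $\pi_1(Q_1)$ under the inclusions, $M'=\widetilde M/G$ with $\widetilde M$ the universal cover,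 $H'$ the lift of $H$ to $T^*M'$. Then $c(L;Q_0,Q_1):=\inf_{u\in C^\infty(M')}\sup_{q\in M'}H'(q,d_qu)$. Definition of $k_\Omega$. Fix $a>0$ with $d_{vv}L(q,v)[w,w]\ge2a|w|^2$ for all $(q,v)\in TM$, $w\in T_qM$; for a magnetic Lagrangian $L(q,v)=\frac12|v|^2+\theta_q(v)$ ($\theta$ a one-form), $a=\frac12$ is taken. Put $\theta_q:=d_vL(q,0)$, with $|\theta_q|$ the dual norm. For a connected component $\Omega$ of $Q_0\cap Q_1$, an isolating family for $\Omega$ is a collection $\nu$ of connected components of $Q_0\cap Q_1$ with $\Omega\in\nu$ for which there is $\epsilon>0$ such that the $\epsilon$-neighborhood of the union of the members of $\nu$ is disjoint from every connected component of $Q_0\cap Q_1$ not in $\nu$. Writing $\nu$ also for this union, $k_\nu:=\min\{c(L;Q_0,Q_1),\ \max_{q\in\nu}E(q,0)+\max_{q\in\nu}\frac{|\theta_q|^2}{4a}\}$ and $k_\Omega:=\inf\{k_\nu\mid\nu\text{ isolating family for }\Omega\}$. (If $\Omega$ is isolated, i.e. $\{\Omega\}$ is an isolating family, then $k_\Omega=k_{\{\Omega\}}$.) *)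

(* Defs.v *)
From HB Require Import structures.
From mathcomp Require Import all_boot all_order all_algebra.
From mathcomp Require Import all_classical all_reals all_analysis.

Set Implicit Arguments.
Unset Strict Implicit.
Unset Printing Implicit Defensive.

Import Order.TTheory GRing.Theory Num.Theory.
Import numFieldNormedType.Exports.

Local Open Scope classical_set_scope.
Local Open Scope ring_scope.

(* For finite-dimensional V and open U this is the usual class C^n: all partial
   derivatives of order at most n exist and are continuous on U. *)
Fixpoint Ck {R : realType} {V W : normedModType R} (n : nat) (U : set V)
    (f : V -> W) : Prop :=
  (forall x, U x -> {for x, continuous f}) /\
  match n with
  | 0%N => True
  | m.+1 => forall v, (forall x, U x -> derivable f x v) /\
                      Ck m U (fun x => 'D_v f x)
  end.

Definition smooth_on {R : realType} {V W : normedModType R} (U : set V)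
  (f : V -> W) : Prop := forall n, Ck n U f.

(* A partial homeomorphism onto an open subset of the plane; cmap and cinv are
   only meaningful on cdom and ccod. *)
Record chart (R : realType) (M : topologicalType) := Chart {
  cdom : set M;
  ccod : set 'rV[R]_2;
  cmap : M -> 'rV[R]_2;
  cinv : 'rV[R]_2 -> M;
  cdom_open : open cdom;
  ccod_open : open ccod;
  cmap_cod : forall q, cdom q -> ccod (cmap q);
  cinv_dom : forall x, ccod x -> cdom (cinv x);
  cmapK : forall q, cdom q -> cinv (cmap q) = q;
  cinvK : forall x, ccod x -> cmap (cinv x) = x;
  cmap_continuous : forall q, cdom q -> {for q, continuous cmap};
  cinv_continuous : forall x, ccod x -> {for x, continuous cinv} }.

Section transition.
Context {R : realType} {M : topologicalType}.
Implicit Types phi psi : chart R M.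

Definition transition phi psi : 'rV[R]_2 -> 'rV[R]_2 := cmap psi \o cinv phi.

Definition overlap phi psi : set 'rV[R]_2 :=
  [set x | ccod phi x /\ cdom psi (cinv phi x)].

Definition smooth_transition phi psi : Prop :=
  smooth_on (overlap phi psi) (transition phi psi).

End transition.

(* The preferred charts chart_at serve only to realise the tangent bundle: the
   tangent space at q is 'rV[R]_2, a vector being given by its coordinates in
   chart_at q. *)
Record surface (R : realType) := Surface {
  carrier :> topologicalType;
  atlas : set (chart R carrier);
  chart_at : carrier -> chart R carrier;
  chart_at_atlas : forall q, atlas (chart_at q);
  chart_at_dom : forall q, cdom (chart_at q) q;
  atlas_compat : forall phi psi, atlas phi -> atlas psi ->
    smooth_transition phi psi;
  surface_hausdorff : hausdorff_space carrier;
  surface_countable : @second_countable carrier }.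

Section surfaces.
Context {R : realType} (M : surface R).
Implicit Types (phi psi : chart R M) (q : M) (v w : 'rV[R]_2).

Definition maximal_atlas : set (chart R M) :=
  [set phi | forall psi, atlas psi ->
    smooth_transition phi psi /\ smooth_transition psi phi].

Definition orientable : Prop :=
  exists A : set (chart R M),
    [/\ A `<=` maximal_atlas,
        forall q, exists2 phi, A phi & cdom phi q &
        forall phi psi, A phi -> A psi -> forall x, overlap phi psi x ->
          0 < \det ('J (transition phi psi) x)].

Definition closed_connected_orientable : Prop :=
  [/\ compact [set: M], connected [set: M] & orientable].

(* The tangent vector at q whose coordinates in phi are w. *)
Definition of_chart phi q w : 'rV[R]_2 :=
  'D_w (transition phi (chart_at q)) (cmap phi q).

(* Coordinate expression, in the chart of the tangent bundle induced by phi, of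
   a function on the tangent bundle. *)
Definition in_chart (F : M -> 'rV[R]_2 -> R) phi (z : 'rV[R]_2 * 'rV[R]_2) : R :=
  F (cinv phi z.1) (of_chart phi (cinv phi z.1) z.2).

Definition smooth_TM (F : M -> 'rV[R]_2 -> R) : Prop :=
  forall phi, atlas phi -> smooth_on [set z | ccod phi z.1] (in_chart F phi).

Definition curve_Ck (n : nat) (I : set R) (c : R -> M) : Prop :=
  (forall t, I t -> {for t, continuous c}) /\
  (forall phi, atlas phi -> Ck n (I `&` c @^-1` cdom phi) (cmap phi \o c)).

Definition velocity (c : R -> M) (t : R) : 'rV[R]_2 :=
  derive1 (cmap (chart_at (c t)) \o c) t.

(* A closed embedded submanifold without boundary, of some dimension d <= 2,
   given by slice charts. *)
Definition submanifold (Q : set M) : Prop :=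
  exists2 d : nat, (d <= 2)%N &
    forall q, Q q -> exists phi,
      [/\ maximal_atlas phi, cdom phi q &
          forall p, cdom phi p ->
            (Q p <-> forall i : 'I_2, (d <= i)%N -> cmap phi p ord0 i = 0)].

Definition closed_connected_submanifold (Q : set M) : Prop :=
  [/\ submanifold Q, compact Q, connected Q & Q !=set0].

Definition tangent (Q : set M) q : set 'rV[R]_2 :=
  [set v | exists (I : set R) (c : R -> M),
    [/\ open I /\ I 0, forall n, curve_Ck n I c, forall t, I t -> Q (c t),
        c 0 = q & velocity c 0 = v]].

Definition riemannian_metric (g : M -> 'rV[R]_2 -> 'rV[R]_2 -> R) : Prop :=
  [/\ forall q v (b : R) w1 w2, g q v (b *: w1 + w2) = b * g q v w1 + g q v w2,
      forall q v w, g q v w = g q w v,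
      forall q v, v != 0 -> 0 < g q v v &
      forall phi, atlas phi -> forall w1 w2,
        smooth_on (ccod phi) (fun x => g (cinv phi x)
          (of_chart phi (cinv phi x) w1) (of_chart phi (cinv phi x) w2))].

Section metric.
Variable g : M -> 'rV[R]_2 -> 'rV[R]_2 -> R.

Definition gnorm q v : R := Num.sqrt (g q v v).

Definition dual_norm q (p : 'rV[R]_2 -> R) : R :=
  sup [set `|p v| | v in [set v | gnorm q v <= 1]].

Definition curve_length (c : R -> M) : \bar R :=
  (\int[lebesgue_measure]_(t in `[0%R, 1%R]) (gnorm (c t) (velocity c t))%:E)%E.

Definition riemannian_distance (x y : M) : \bar R :=
  ereal_inf [set curve_length c | c in [set c : R -> M | c 0 = x /\ c 1 = y /\
    exists I : set R, [/\ open I, `[0, 1] `<=` I & curve_Ck 1 I c]]].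

Definition neighborhood (A : set M) (e : R) : set M :=
  [set y | exists2 x, A x & (riemannian_distance x y < e%:E)%E].

End metric.

Section lagrangian.
Variable L : M -> 'rV[R]_2 -> R.

Definition dvL q v w : R := 'D_w (L q) v.

Definition dvvL q v w : R := 'D_w (fun v' => 'D_w (L q) v') v.

(* Superlinearity does not depend on the norm chosen on each fibre. *)
Definition tonelli : Prop :=
  [/\ smooth_TM L,
      forall q v w, w != 0 -> 0 < dvvL q v w &
      forall q (K : R), exists r : R, forall v, r < `|v| -> K * `|v| <= L q v].

Definition energy q v : R := dvL q v v - L q v.

(* A curve on the compact interval [0, T] is of class C^2 if it extends to a C^2
   curve on an open interval; (0, w) and (w, 0) are the fibre and base
   directions in the coordinates of the tangent bundle induced by phi. *)
Definition euler_lagrange_orbit (T : R) (c : R -> M) : Prop :=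
  (exists I : set R, [/\ open I, `[0, T] `<=` I & curve_Ck 2 I c]) /\
  forall t, 0 <= t <= T -> forall phi, atlas phi -> cdom phi (c t) ->
    let x := cmap phi \o c in
    forall w,
      is_derive t (1 : R) (fun s => 'D_(0, w) (in_chart L phi) (x s, derive1 x s))
        ('D_(w, 0) (in_chart L phi) (x t, derive1 x t)).

Definition connecting_orbit (Q0 Q1 : set M) (T : R) (c : R -> M) : Prop :=
  [/\ 0 < T, euler_lagrange_orbit T c, Q0 (c 0) /\ Q1 (c T),
      forall w, tangent Q0 (c 0) w -> dvL (c 0) (velocity c 0) w = 0 &
      forall w, tangent Q1 (c T) w -> dvL (c T) (velocity c T) w = 0].

Definition has_energy (k T : R) (c : R -> M) : Prop :=
  forall t, 0 <= t <= T -> energy (c t) (velocity c t) = k.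

(* For a Tonelli Lagrangian and a linear p the supremum is a maximum. *)
Definition hamiltonian q (p : 'rV[R]_2 -> R) : R :=
  sup (range (fun v => p v - L q v)).

Definition meets_conormal (k : R) (Q : set M) : Prop :=
  exists q (p : {scalar 'rV[R]_2}),
    [/\ Q q, tangent Q q `<=` [set v | p v = 0] & hamiltonian q p = k].

Definition k_conormal (Q0 Q1 : set M) : \bar R :=
  ereal_inf [set k%:E | k in
    [set k : R | meets_conormal k Q0 /\ meets_conormal k Q1]].

End lagrangian.

(* Paths are parametrised by [0, 1]; values outside [0, 1] are irrelevant. *)
Definition is_path (c : R -> M) (x y : M) : Prop :=
  [/\ {within `[0, 1], continuous c}, c 0 = x & c 1 = y].

Definition concat (c d : R -> M) : R -> M :=
  fun t => if t <= 2^-1 then c (2 * t) else d (2 * t - 1).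

Definition reverse (c : R -> M) : R -> M := fun t => c (1 - t).

Definition homotopic (c d : R -> M) : Prop :=
  exists h : R * R -> M,
    [/\ {within `[0, 1] `*` `[0, 1], continuous h},
        forall t, 0 <= t <= 1 -> h (0, t) = c t,
        forall t, 0 <= t <= 1 -> h (1, t) = d t &
        forall s, 0 <= s <= 1 -> h (s, 0) = c 0 /\ h (s, 1) = c 1].

Section covering.
Variable x0 : M.

(* Normal subgroups of the fundamental group at x0, as homotopy-invariant sets
   of loops. *)
Definition normal_subgroup (N : set (R -> M)) : Prop :=
  [/\ forall c, N c -> is_path c x0 x0,
      forall c d, N c -> is_path d x0 x0 -> homotopic c d -> N d,
      N (cst x0),
      (forall c d, N c -> N d -> N (concat c d)) /\
      (forall c, N c -> N (reverse c)) &
      forall c d, N c -> is_path d x0 x0 ->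
        N (concat (concat d c) (reverse d))].

(* The image of the fundamental group of Q, transported to x0 along an
   arbitrary path; the choice of path is immaterial up to conjugation. *)
Definition image_pi1 (Q : set M) : set (R -> M) :=
  [set l | exists q c d,
    [/\ is_path d x0 q, is_path c q q, forall t, 0 <= t <= 1 -> Q (c t) &
        l = concat (concat d c) (reverse d)]].

Definition G_subgroup (Q0 Q1 : set M) : set (R -> M) :=
  \bigcap_(N in [set N | [/\ normal_subgroup N, image_pi1 Q0 `<=` N &
                            image_pi1 Q1 `<=` N]]) N.

(* The universal cover is the set of homotopy classes of paths issued from x0,
   projecting to their endpoint; M' is its quotient by G, acting by
   precomposition.  Points of M' are represented by paths issued from x0. *)
Definition based_path : set (R -> M) := [set c | is_path c x0 (c 1)].

Definition cover_eq (Q0 Q1 : set M) (c d : R -> M) : Prop :=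
  exists2 l, G_subgroup Q0 Q1 l & homotopic d (concat l c).

(* A function u on M' near the point of c, read in the chart phi: the point of
   M' close to c and lying over cinv phi x is obtained by following c and then
   the phi-segment to x. *)
Definition cover_chart (u : (R -> M) -> R) (c : R -> M) phi (x : 'rV[R]_2) : R :=
  u (concat c (fun t => cinv phi ((1 - t) *: cmap phi (c 1) + t *: x))).

Definition smooth_cover (Q0 Q1 : set M) : set ((R -> M) -> R) :=
  [set u |
    (forall c d, based_path c -> based_path d -> cover_eq Q0 Q1 c d ->
      u c = u d) /\
    (forall c phi, based_path c -> atlas phi -> cdom phi (c 1) ->
      exists r : R, [/\ 0 < r, ball (cmap phi (c 1)) r `<=` ccod phi &
        smooth_on (ball (cmap phi (c 1)) r) (cover_chart u c phi)])].

(* The differential of u at the point of c, as a covector at c 1 through the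
   differential of the covering map M' -> M. *)
Definition dcover (u : (R -> M) -> R) (c : R -> M) v : R :=
  'D_v (cover_chart u c (chart_at (c 1))) (cmap (chart_at (c 1)) (c 1)).

Definition mane_value (L : M -> 'rV[R]_2 -> R) (Q0 Q1 : set M) : \bar R :=
  ereal_inf [set
    ereal_sup [set (hamiltonian L (c 1) (dcover u c))%:E | c in based_path]
    | u in smooth_cover Q0 Q1].

End covering.

Definition component (A : set M) : set (set M) :=
  [set connected_component A x | x in A].

Definition isolating_family (g : M -> 'rV[R]_2 -> 'rV[R]_2 -> R)
    (Q0 Q1 : set M) (Omega : set M) : set (set (set M)) :=
  [set nu | [/\ nu `<=` component (Q0 `&` Q1), nu Omega &
    exists2 e : R, 0 < e &
      forall Z, component (Q0 `&` Q1) Z -> ~ nu Z ->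
        neighborhood g (\bigcup_(Y in nu) Y) e `&` Z = set0]].

Definition theta (L : M -> 'rV[R]_2 -> R) q : 'rV[R]_2 -> R := dvL L q 0.

Definition magnetic (g : M -> 'rV[R]_2 -> 'rV[R]_2 -> R)
    (L : M -> 'rV[R]_2 -> R) : Prop :=
  exists th : M -> {scalar 'rV[R]_2},
    forall q v, L q v = 2^-1 * gnorm g q v ^+ 2 + th q v.

(* The constants a that may be fixed in the definition of k_Omega. *)
Definition admissible (g : M -> 'rV[R]_2 -> 'rV[R]_2 -> R)
    (L : M -> 'rV[R]_2 -> R) (a : R) : Prop :=
  [/\ 0 < a, forall q v w, 2 * a * gnorm g q w ^+ 2 <= dvvL L q v w &
      magnetic g L -> a = 2^-1].

Definition k_nu (x0 : M) (g : M -> 'rV[R]_2 -> 'rV[R]_2 -> R)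
    (L : M -> 'rV[R]_2 -> R) (a : R) (Q0 Q1 : set M) (nu : set (set M)) :
    \bar R :=
  let N := \bigcup_(Y in nu) Y in
  Order.min (mane_value x0 L Q0 Q1)
    (ereal_sup [set (energy L q 0)%:E | q in N] +
     ereal_sup [set (dual_norm g q (theta L q) ^+ 2 / (4 * a))%:E | q in N])%E.

Definition k_Omega (x0 : M) (g : M -> 'rV[R]_2 -> 'rV[R]_2 -> R)
    (L : M -> 'rV[R]_2 -> R) (a : R) (Q0 Q1 Omega : set M) : \bar R :=
  ereal_inf [set k_nu x0 g L a Q0 Q1 nu
            | nu in isolating_family g Q0 Q1 Omega].

End surfaces.

(* Main.v *)
Require Import Defs.
From HB Require Import structures.
From mathcomp Require Import all_boot all_order all_algebra.
From mathcomp Require Import all_classical all_reals all_analysis.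
From mathcomp Require Import ring lra.
Import Order.TTheory GRing.Theory Num.Theory.
Import numFieldNormedType.Exports.
Local Open Scope classical_set_scope.
Local Open Scope ring_scope.

(** Take Q0 = Sigma and Q1 = {x0}.  For a metric g, a vector field X and a
    function W, the Lagrangian L(q, v) = |v - X|^2 / 2 - W has H(q, 0) = W(q) and
    E(q, v) = |v|^2 / 2 - |X|^2 / 2 + W.  An orbit leaving Sigma conormally starts
    with momentum 0, so its energy is the value of W at its starting point.

    Let b be a bump function in a chart around x0, with b(x0) = 1 and b = 0 far
    from x0.  Put W = -(2b - 1)(3b - 2), which is -1 at x0, at least -1 where
    b >= 1/2, 0 where b = 1/2 and -2 where b = 0; and let X be a multiple of
    b (b - 1/2) with |X(x0)|^2 = 2.  Then k = -2 (at a point where b = 0 with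
    momentum 0, and at x0), k_Omega = E(x0, 0) + |X(x0)|^2 / 2 = -1, and c >= 0
    because E = 0 on the zero vectors over {b = 1/2}.  An orbit of energy k < -1
    starts in {W = k}, hence in {b < 1/2}, and cannot reach x0 because over
    {b = 1/2} the energy is |v|^2 / 2 >= 0. *)

Set Implicit Arguments.
Unset Strict Implicit.

(** * Calculus of C^k maps *)

Section Ck_general.
Context {R : realType} {V W : normedModType R}.
Implicit Types (U : set V) (f g : V -> W).

Lemma Ck_sub n U U' f : U' `<=` U -> Ck n U f -> Ck n U' f.
Proof.
elim: n f => [|n IH] f UU' /= [cf df]; split => //; first by move=> x /UU'/cf.
  by move=> x /UU'/cf.
by move=> v; have [d1 d2] := df v; split; [move=> x /UU'/d1|exact: IH].
Qed.

(** Every clause of [Ck] concerns the germ of [f] at a point of [U], with limits taken in the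
    ambient space, so it can be tested one point at a time. *)
Lemma Ck_pointwise n U f : (forall x, U x -> Ck n [set x] f) -> Ck n U f.
Proof.
elim: n f => [|n IH] f H /=; split.
- by move=> x Ux; have [c _] := H x Ux; exact: c.
- by [].
- by move=> x Ux; have [c _] := H x Ux; exact: c.
move=> v; split; first by move=> x Ux; have [_ /(_ v)[d _]] := H x Ux; exact: d.
by apply: IH => x Ux; have [_ /(_ v)[]] := H x Ux.
Qed.

Lemma Ck_local n U f :
  (forall x, U x -> exists2 P, P x & Ck n P f) -> Ck n U f.
Proof.
move=> H; apply: Ck_pointwise => x /H[P Px]; apply: Ck_sub.
by move=> _ ->.
Qed.

Lemma Ck_continuous n U f x : Ck n U f -> U x -> {for x, continuous f}.
Proof. by case: n => [|n] [c _]; exact: c. Qed.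

Lemma Ck_derivable n U f x v : Ck n.+1 U f -> U x -> derivable f x v.
Proof. by move=> [_ /(_ v)[d _]]; exact: d. Qed.

Lemma Ck_derive n U f v : Ck n.+1 U f -> Ck n U ('D_v f).
Proof. by move=> [_ /(_ v)[]]. Qed.

Lemma CkS n U f : Ck n.+1 U f -> Ck n U f.
Proof.
elim: n f => [|n IH] f [cf df]; first by split.
by split => // v; have [d1 d2] := df v; split => //; exact: IH.
Qed.

(** Openness of [U] turns equality on [U] into equality near each of its points, which continuity
    and derivatives respect. *)
Lemma Ck_eq n U f g : open U -> {in U, f =1 g} -> Ck n U f -> Ck n U g.
Proof.
move=> oU; elim: n f g => [|n IH] f g fg.
all: have nfg x : U x -> \forall y \near x, f y = g y
  by move=> Ux; near=> y; apply: fg; rewrite inE; near: y; exact: open_nbhs_nbhs.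
all: have cfg : (forall x, U x -> {for x, continuous f}) ->
      forall x, U x -> {for x, continuous g}
  by move=> cf x Ux; rewrite /prop_for /continuous_at -(fg x) ?inE//; apply: cvg_trans (cf x Ux);
     apply: near_eq_cvg; apply: filterS (nfg x Ux) => y ->.
  by move=> [cf _]; split=> //; exact: cfg.
move=> [cf df]; split; first exact: cfg.
move=> v; have [d1 d2] := df v; split.
  by move=> x Ux; apply: near_eq_derivable (d1 _ Ux); exact: nfg.
apply: IH d2 => x; rewrite inE => Ux; apply: near_eq_derive; exact: nfg.
Unshelve. all: by end_near. Qed.

Lemma Ck_cst n U (a : W) : Ck n U (cst a).
Proof.
elim: n a => [|n IH] a; split=> //=.
- by move=> x _; exact: cst_continuous.
- by move=> x _; exact: cst_continuous.
move=> v; split; first by move=> x _; exact: derivable_cst.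
rewrite [X in Ck _ _ X](_ : _ = cst 0) //.
by apply/funext => x; exact: derive_cst.
Qed.

Lemma CkD n U f g : open U -> Ck n U f -> Ck n U g -> Ck n U (f \+ g).
Proof.
move=> oU; elim: n f g => [|n IH] f g [cf df] [cg dg]; split=> //.
- by move=> x Ux; apply: continuousD; [exact: cf|exact: cg].
- by move=> x Ux; apply: continuousD; [exact: cf|exact: cg].
move=> v; have [f1 f2] := df v; have [g1 g2] := dg v; split.
  by move=> x Ux; apply: derivableD; [exact: f1|exact: g1].
apply: (Ck_eq oU _ (IH _ _ f2 g2)) => x; rewrite inE => Ux /=.
by rewrite deriveD//; [exact: f1|exact: g1].
Qed.

Lemma CkZ n U (k : R) f : open U -> Ck n U f -> Ck n U (k \*: f).
Proof.
move=> oU; elim: n f => [|n IH] f [cf df]; split=> //.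
- by move=> x Ux; apply: continuousZl_tmp; exact: cf.
- by move=> x Ux; apply: continuousZl_tmp; exact: cf.
move=> v; have [f1 f2] := df v; split.
  by move=> x Ux; apply: derivableZ; exact: f1.
apply: (Ck_eq oU _ (IH _ f2)) => x; rewrite inE => Ux /=.
by rewrite deriveZ//; exact: f1.
Qed.

Lemma Ck_sum (I : Type) (r : seq I) (F : I -> V -> W) n U : open U ->
  (forall i, Ck n U (F i)) -> Ck n U (fun x => \sum_(i <- r) F i x).
Proof.
move=> oU H; elim: r => [|i r IH].
  by under eq_fun do rewrite big_nil; exact: Ck_cst.
by under eq_fun do rewrite big_cons; exact: CkD.
Qed.

Lemma Ck_linear n U (f : {linear V -> W}) : continuous f -> Ck n U f.
Proof.
move=> cf; have df x v : is_derive x v f (f v).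
  have d : differentiable f x by exact: linear_differentiable.
  by split; [exact: diff_derivable|rewrite deriveE// diff_lin].
case: n => [|n]; split=> //=; try by move=> x _; exact: cf.
move=> v; split; first by move=> x _; exact: ex_derive.
rewrite (_ : 'D_v f = cst (f v)); first exact: Ck_cst.
by apply/funext => x; exact: derive_val.
Qed.

End Ck_general.

Section Ck_scalar.
Context {R : realType} {V : normedModType R}.
Implicit Types (U : set V) (f g : V -> R).

Lemma CkM n U f g : open U -> Ck n U f -> Ck n U g -> Ck n U (f \* g).
Proof.
move=> oU; elim: n f g => [|n IH] f g.
  by move=> [cf df] [cg dg]; split=> // x Ux; apply: continuousM; [exact: cf|exact: cg].
move=> hf hg; have [cf df] := hf; have [cg dg] := hg; split=> //.
  by move=> x Ux; apply: continuousM; [exact: cf|exact: cg].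
move=> v; have [f1 f2] := df v; have [g1 g2] := dg v; split.
  by move=> x Ux; apply: derivableM; [exact: f1|exact: g1].
have := CkD oU (IH _ _ (CkS hf) g2) (IH _ _ (CkS hg) f2).
apply: Ck_eq => // x; rewrite inE => Ux /=.
by rewrite deriveM//; [exact: f1|exact: g1].
Qed.

End Ck_scalar.

Section chain_rule.
Context {R : realType} {U V W : normedModType R}.

(** The map [h] has a derivative only in the direction [v]. Restricted to the line t -> t v + x it
    is a differentiable function of a real variable, to which the Fréchet chain rule applies. *)
Lemma is_derive_comp (f : V -> W) (h : U -> V) x v :
  differentiable f (h x) -> derivable h x v ->
  is_derive x v (f \o h) ('d f (h x) ('D_v h x)).
Proof.
move=> df dh; pose k (t : R) := h (t *: v + x).
have k0 : k 0 = h x by rewrite /k scale0r add0r.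
have line (T : normedModType R) (u : U -> T) : 'D_v u x = 'D_1 (fun t : R => u (t *: v + x)) (0 : R).
  rewrite /derive; set g1 := fun t => _; set g2 := fun t => _.
  suff -> : g1 = g2 by []; apply/funext => t; rewrite /g1 /g2 /=.
  by rewrite addr0 scale0r add0r [_%:A]mulr1.
have /derivable1_diffP dk := (derivable1P _ _ _).1 dh.
have dfk : differentiable (f \o k) (0 : R).
  by apply: differentiable_comp => //; rewrite k0.
split; first exact: (derivable1P (f \o h) x v).2 (diff_derivable dfk).
by rewrite (line _ (f \o h)) (line _ h) -/k (deriveE _ dfk) diff_comp ?k0// (deriveE _ dk).
Qed.

End chain_rule.

Lemma differentiable_of_bound {R : realType} {V W : normedModType R}
    (f : V -> W) (a : V) (l : {linear V -> W}) : continuous l ->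
  (forall eps : R, 0 < eps ->
    \forall h \near 0, `|f (a + h) - f a - l h| <= eps * `|h|) ->
  differentiable f a.
Proof.
move=> cl H; suff dxf : f \o shift a = cst (f a) + l +o_ 0 id.
  by apply/diff_locallyP; rewrite (diff_unique cl dxf).
apply/eqaddoP => eps /H; apply: filterS => h.
rewrite [leRHS]/= -[X in _ -> `|X| <= _]/(f (h + a) - (f a + l h)).
by rewrite opprD addrA [h + a]addrC.
Qed.

Section rV_norm.
Context {R : realType} {n : nat}.
Implicit Types z : 'rV[R]_n.

Lemma coord_le_norm z i : `|z 0 i| <= `|z|.
Proof. by rewrite [leRHS]/Num.norm/= mx_normrE; exact: (le_bigmax _ _ (0, i)). Qed.

Lemma rV_norm_le z (c : R) : 0 <= c -> (forall i, `|z 0 i| <= c) -> `|z| <= c.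
Proof.
move=> c0 zc; rewrite [leLHS]/Num.norm/= mx_normrE; apply/bigmax_leP.
by split=> // -[i0 j] _ /=; rewrite ord1.
Qed.

End rV_norm.

(** * Differentiability from continuous partial derivatives *)

Section partial_derivatives.
Context {R : realType} {n : nat}.
Implicit Types (f : 'rV[R]_n -> R) (a d : 'rV[R]_n).

Local Notation e := (delta_mx (0 : 'I_1)).

(** The mean value theorem is applied on [0, t] or on [t, 0]; bounding [s] in absolute value covers
    both signs of [t]. *)
Lemma MVT_line f a (i : 'I_n) (t : R) :
  (forall s : R, `|s| <= `|t| -> derivable f (a + s *: e i) (e i)) ->
  exists2 s : R, `|s| <= `|t| & f (a + t *: e i) - f a = t * 'D_(e i) f (a + s *: e i).
Proof.
move=> df; pose k (s : R) := f (a + s *: e i).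
have dk (s : R) : `|s| <= `|t| -> is_derive s (1 : R) k ('D_(e i) f (a + s *: e i)).
  move=> st; have k1 : (fun h : R => h^-1 *: ((k \o shift s) (h *: 1) - k s)) =
      (fun h => h^-1 *: ((f \o shift (a + s *: e i)) (h *: e i) - f (a + s *: e i))).
    by apply/funext => h; rewrite /k /= [_%:A]mulr1 scalerDl addrCA.
  by split; [have := df _ st; rewrite /derivable k1|rewrite /derive k1].
have ck (b c : R) : (forall s, s \in `[b, c]%R -> `|s| <= `|t|) ->
    {within `[b, c], continuous k}.
  move=> bc; apply: derivable_within_continuous => s /bc/dk ds.
  exact: ex_derive.
have k0 : k 0 = f a by rewrite /k scale0r addr0.
have kt : k t = f (a + t *: e i) by [].
have [t0|t0] := leP 0 t.
  have sub s : s \in `[0, t]%R -> `|s| <= `|t|.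
    by rewrite in_itv/= => /andP[s0 st]; rewrite !ger0_norm.
  have [||s /sub st E] := @MVT_segment R k (fun s => 'D_(e i) f (a + s *: e i)) 0 t t0.
  - by move=> s st; apply/dk/sub/subset_itv_oo_cc.
  - exact: ck.
  by exists s => //; rewrite -kt -k0 E subr0 mulrC.
have sub s : s \in `[t, 0]%R -> `|s| <= `|t|.
  by rewrite in_itv/= => /andP[s0 st]; rewrite !ler0_norm ?lerN2// ltW.
have [||s /sub st E] := @MVT_segment R k (fun s => 'D_(e i) f (a + s *: e i)) t 0 (ltW t0).
- by move=> s st; apply/dk/sub/subset_itv_oo_cc.
- exact: ck.
by exists s => //; rewrite -kt -k0 -opprB E sub0r mulrN opprK mulrC.
Qed.

(** The point [a + h] is reached from [a] by changing one coordinate at a time. On each edge the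
    mean value theorem compares the increment of [f] with the partial derivative at [a]. *)
Lemma differentiable_partial f a :
  (forall i, \forall y \near a, derivable f y (e i)) ->
  (forall i, {for a, continuous ('D_(e i) f)}) -> differentiable f a.
Proof.
move=> nf cf.
pose l (h : 'rV[R]_n) := \sum_i h 0 i * 'D_(e i) f a.
have lin_l : linear l.
  move=> k x y; rewrite /l scaler_sumr -big_split; apply: eq_bigr => i _ /=.
  by rewrite !mxE mulrDl -mulrA.
pose lM := GRing.isLinear.Build _ _ _ _ _ lin_l.
pose lL : {linear _ -> _} := HB.pack l lM.
have cl : continuous lL.
  have ci (i : 'I_n) : continuous (fun h : 'rV[R]_n => h 0 i * 'D_(e i) f a).
    move=> x.
    apply: (@continuousM _ _ (fun h : 'rV[R]_n => h 0 i) (cst ('D_(e i) f a))).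
      exact: coord_continuous.
    exact: cst_continuous.
  move=> x; apply: (@Ck_continuous _ _ _ 0 setT) => //.
  by apply: Ck_sum => [|i]; [exact: openT|split=> // y _; exact: ci].
apply: (differentiable_of_bound cl) => eps eps0.
(* Each of the [n] edges is allowed an error of eps / (n + 1) times the norm of [h]; this
   denominator is nonzero also for n = 0. *)
have d0 : 0 < eps / n.+1%:R by rewrite divr_gt0.
have {}nf : \forall z \near (0 : 'rV[R]_n), forall i,
    derivable f (a + z) (e i) /\ `|'D_(e i) f (a + z) - 'D_(e i) f a| <= eps / n.+1%:R.
  have H i : \forall z \near (0 : 'rV[R]_n), derivable f (a + z) (e i) /\
      `|'D_(e i) f (a + z) - 'D_(e i) f a| <= eps / n.+1%:R.
    have : \forall y \near a, derivable f y (e i) /\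
        `|'D_(e i) f y - 'D_(e i) f a| <= eps / n.+1%:R.
      apply: filterI; first exact: nf.
      by have /cvgrPdist_le/(_ _ d0) := cf i; apply: filterS => y; rewrite distrC.
    by rewrite (near_shift (0 : 'rV[R]_n)); apply: filterS => y /=; rewrite subr0 addrC.
  exact: (filter_forall _ H).
have [r r0 {}nf] := (nbhs_ballP _ _).1 nf.
near=> h.
have hr : `|h| < r.
  near: h; apply: filterS (nbhsx_ballx (0 : 'rV[R]_n) r r0) => z.
  by rewrite -ball_normE/= sub0r normrN.
(* The vertices of the path: [p k] keeps the first [k] coordinates of [h]. *)
pose p (k : nat) : 'rV[R]_n := \row_i (if (i < k)%N then h 0 i else 0).
have pn : p n = h by apply/rowP => i; rewrite mxE ltn_ord.
have p0 : p 0 = 0 by apply/rowP => i; rewrite !mxE.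
have pS (i : 'I_n) : p i.+1 = p i + h 0 i *: e i.
  apply/rowP => j; rewrite !mxE/= ltnS leq_eqVlt -val_eqE/=.
  by case: (ltngtP j i) => //= [||/val_inj ->]; rewrite ?(mulr0, mulr1, addr0, add0r).
have step (i : 'I_n) :
    `|f (a + p i.+1) - f (a + p i) - h 0 i * 'D_(e i) f a| <= `|h| * (eps / n.+1%:R).
  have small (s : R) : `|s| <= `|h 0 i| -> ball 0 r (p i + s *: e i).
    move=> sh; rewrite -ball_normE/= sub0r normrN; apply: le_lt_trans hr.
    apply: rV_norm_le => // j; rewrite !mxE eqxx/=; have [->|ji] := eqVneq j i.
      by rewrite ltnn add0r mulr1 (le_trans sh) ?coord_le_norm.
    by rewrite mulr0 addr0; case: ifP; rewrite ?normr0 ?coord_le_norm.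
  have [|s /small/nf/(_ i)[_ Ds]] := @MVT_line f (a + p i) i (h 0 i).
    by move=> s /small/nf/(_ i)[]; rewrite addrA.
  rewrite pS addrA => ->; rewrite -mulrBr normrM -[X in 'D_ _ _ X - _]addrA.
  by rewrite ler_pM// coord_le_norm.
have -> : f (a + h) - f a - l h =
    \sum_(i < n) (f (a + p i.+1) - f (a + p i) - h 0 i * 'D_(e i) f a).
  rewrite sumrB -(big_mkord xpredT (fun i => f (a + p i.+1) - f (a + p i))).
  by rewrite telescope_sumr// pn p0 addr0.
apply: le_trans (ler_norm_sum _ _ _) _; apply: le_trans (ler_sum _ (fun i _ => step i)) _.
rewrite sumr_const card_ord -[leLHS]mulr_natr.
rewrite [leLHS](_ : _ = (n%:R / n.+1%:R) * (eps * `|h|)); last by ring.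
by rewrite ler_piMl ?mulr_ge0 ?(ltW eps0)// ler_pdivrMr// mul1r ler_nat.
Unshelve. all: by end_near. Qed.

End partial_derivatives.

Section Ck_coordinates.
Context {R : realType} {V : normedModType R}.

Lemma Ck_differentiable n k (P : set 'rV[R]_n) (f : 'rV[R]_n -> R) a : open P ->
  P a -> Ck k.+1 P f -> differentiable f a.
Proof.
move=> oP Pa [_ df]; apply: differentiable_partial => i.
  near=> y; apply: (df _).1; near: y; exact: open_nbhs_nbhs.
exact: Ck_continuous (df _).2 Pa.
Unshelve. all: by end_near. Qed.

(** Written with partial derivatives, the chain rule has a right-hand side made of sums, products
    and compositions, as the induction in [Ck_comp_rV] requires. *)
Lemma is_derive_comp_rV n k (P : set 'rV[R]_n) (f : 'rV[R]_n -> R)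
    (h : V -> 'rV[R]_n) x v : open P -> P (h x) -> Ck k.+1 P f -> derivable h x v ->
  is_derive x v (f \o h) (\sum_i 'D_v (fun y => h y 0 i) x * 'D_(delta_mx 0 i) f (h x)).
Proof.
move=> oP Px Cf dh; have df := Ck_differentiable oP Px Cf.
apply: is_derive_eq (is_derive_comp df dh) _.
rewrite {1}['D_v h x]row_sum_delta linear_sum; apply: eq_bigr => i _ /=.
by rewrite linearZ/= (deriveE _ df) derive_mx// mxE.
Qed.

Lemma coord_continuous_at n (h : V -> 'rV[R]_n) x i :
  {for x, continuous h} -> {for x, continuous (fun y => h y 0 i)}.
Proof. by move=> ch; exact: continuous_comp ch (@coord_continuous R 1 n 0 i (h x)). Qed.

Lemma continuous_coord n (h : V -> 'rV[R]_n) x :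
  (forall i, {for x, continuous (fun y => h y 0 i)}) -> {for x, continuous h}.
Proof.
move=> ch; apply/cvgrPdist_le => eps eps0.
have H i : \forall y \near x, `|h x 0 i - h y 0 i| <= eps.
  by have /cvgrPdist_le/(_ _ eps0) := ch i.
apply: filterS (filter_forall _ H) => y yP.
by apply: rV_norm_le => [|i]; [exact: ltW|rewrite !mxE].
Qed.

Lemma Ck_coord n k (U : set V) (h : V -> 'rV[R]_n) : open U ->
  Ck k U h <-> forall i, Ck k U (fun x => h x 0 i).
Proof.
move=> oU.
have cont : (forall x, U x -> {for x, continuous h}) <->
    forall i x, U x -> {for x, continuous (fun y => h y 0 i)}.
  split=> [ch i x Ux|ch x Ux]; last by apply: continuous_coord => i; exact: ch.
  exact: coord_continuous_at (ch _ Ux).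
elim: k h cont => [|k IH] h cont.
  by split=> [[/cont ch _] i|ch]; split=> //;
    [exact: ch|apply/cont => i x; exact: Ck_continuous].
have IH' (g : V -> 'rV[R]_n) : Ck k U g <-> forall i, Ck k U (fun x => g x 0 i).
  apply: IH; split=> [cg i x Ux|cg x Ux].
    exact: coord_continuous_at (cg _ Ux).
  by apply: continuous_coord => i; exact: cg.
split=> [[/cont ch dh] i|ch]; split.
- exact: ch.
- move=> v; have [d1 d2] := dh v; split.
    by move=> x /d1 /derivable_mxP.
  apply: Ck_eq ((IH' _).1 d2 i) => // x; rewrite inE => Ux.
  by rewrite derive_mx ?mxE//; exact: d1.
- by apply/cont => i x; exact: Ck_continuous.
move=> v; have d1 x : U x -> derivable h x v.
  by move=> Ux; apply/derivable_mxP => i j; rewrite ord1; exact: Ck_derivable (ch j) Ux.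
split=> //; apply/IH' => i; apply: Ck_eq (Ck_derive v (ch i)) => // x.
by rewrite inE => Ux; rewrite derive_mx ?mxE//; exact: d1.
Qed.

End Ck_coordinates.

(** * Composition of C^k maps *)

Section Ck_composition.
Context {R : realType} {V : normedModType R}.

(** Induction on [k] for all [f] at once: a derivative of [f \o h] is a sum of products of a
    derivative of a coordinate of [h] and a partial derivative of [f] composed with [h]. *)
Lemma Ck_comp_rV n k (U : set V) (P : set 'rV[R]_n) (f : 'rV[R]_n -> R) (h : V -> 'rV[R]_n) :
  open U -> open P -> (forall x, U x -> P (h x)) ->
  Ck k P f -> Ck k U h -> Ck k U (f \o h).
Proof.
move=> oU oP UP; elim: k f => [|k IH] f Cf Ch.
all: have ch : forall x, U x -> {for x, continuous (f \o h)} by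
  move=> x Ux; exact: continuous_comp (Ck_continuous Ch Ux) (Ck_continuous Cf (UP _ Ux)).
- by split.
split=> // v.
have D x : U x -> is_derive x v (f \o h)
    (\sum_i 'D_v (fun y => h y 0 i) x * 'D_(delta_mx 0 i) f (h x)).
  by move=> Ux; apply: is_derive_comp_rV Cf _ => //; [exact: UP|exact: Ck_derivable Ch Ux].
split; first by move=> x /D [].
have : Ck k U (fun x => \sum_i 'D_v (fun y => h y 0 i) x * 'D_(delta_mx 0 i) f (h x)).
  apply: Ck_sum => // i; apply: CkM => //.
    by apply: Ck_derive; apply: (Ck_coord _ _ oU).1.
  exact: (IH _ (Ck_derive _ Cf) (CkS Ch)).
by apply: Ck_eq => // x; rewrite inE => /D [].
Qed.

Lemma Ck_comp_rV_rV m n k (U : set V) (P : set 'rV[R]_n) (f : 'rV[R]_n -> 'rV[R]_m)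
    (h : V -> 'rV[R]_n) :
  open U -> open P -> (forall x, U x -> P (h x)) ->
  Ck k P f -> Ck k U h -> Ck k U (f \o h).
Proof.
move=> oU oP UP /(Ck_coord _ _ oP) Cf Ch; apply/Ck_coord => // i.
exact: (Ck_comp_rV oU oP UP (Cf i) Ch).
Qed.

Lemma Ck_comp_real k (U : set V) (P : set R) (f : R -> R) (h : V -> R) :
  open U -> open P -> (forall x, U x -> P (h x)) ->
  Ck k P f -> Ck k U h -> Ck k U (f \o h).
Proof.
move=> oU oP UP; elim: k f => [|k IH] f Cf Ch.
all: have ch : forall x, U x -> {for x, continuous (f \o h)} by
  move=> x Ux; exact: continuous_comp (Ck_continuous Ch Ux) (Ck_continuous Cf (UP _ Ux)).
- by split.
split=> // v.
have D x : U x -> is_derive x v (f \o h) ('D_v h x * 'D_(1 : R) f (h x)).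
  move=> Ux; have df : differentiable f (h x).
    by apply/derivable1_diffP; exact: Ck_derivable Cf (UP _ Ux).
  apply: is_derive_eq (is_derive_comp df (Ck_derivable Ch Ux)) _.
  by rewrite (deriveE _ df) -[X in 'd _ _ X = _]mulr1 linearZ.
split; first by move=> x /D [].
have : Ck k U (fun x => 'D_v h x * 'D_(1 : R) f (h x)).
  apply: CkM => //; first exact: Ck_derive.
  exact: (IH _ (Ck_derive _ Cf) (CkS Ch)).
by apply: Ck_eq => // x; rewrite inE => /D [].
Qed.

End Ck_composition.

(** * Functions flat at the origin *)

Section flat.
Context {R : realType}.
Implicit Types (k n : nat) (s h : R).

(* The powers of 1/s make the family stable under differentiation, so that
   smoothness follows by induction on the order for all k at once. *)
Definition flat k s : R := if 0 < s then expR (- s^-1) / s ^+ k else 0.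

Lemma flat_ge0 k s : 0 <= flat k s.
Proof. by rewrite /flat; case: ifP => // s0; rewrite divr_ge0 ?expR_ge0// exprn_ge0// ltW. Qed.

Lemma flat_gt0 k s : (0 < flat k s) = (0 < s).
Proof.
rewrite /flat; case: ifP => s0; last by rewrite ltxx.
by rewrite divr_gt0 ?expR_gt0// exprn_gt0.
Qed.

Lemma flat_le0 k s : s <= 0 -> flat k s = 0.
Proof. by rewrite /flat; case: ltP. Qed.

Lemma flat0_le s h : 0 < h -> s <= h -> flat 0 s <= flat 0 h.
Proof.
move=> h0 sh; rewrite /flat h0; case: ifP => [s0|_]; last by rewrite divr_ge0 ?expR_ge0.
by rewrite !expr0 !divr1 ler_expR lerN2 lef_pV2.
Qed.

(** The term of order k + 1 in the series of exp(1/s) is already large enough. The bound yields the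
    derivative at 0 in [is_derive_flat]. *)
Lemma flat_le_linear k s : `|flat k s| <= k.+1`!%:R * `|s|.
Proof.
rewrite ger0_norm ?flat_ge0// /flat; case: ifP => [s0|_]; last by rewrite mulr_ge0.
have t0 : 0 < s^-1 by rewrite invr_gt0.
have E : s^-1 ^+ k.+1 / k.+1`!%:R <= expR s^-1.
  by apply: le_trans (expR_ge1Dxn k (ltW t0)); rewrite lerDr.
rewrite gtr0_norm// expRN -exprVn mulrC ler_pdivrMr ?expR_gt0//.
have F0 : 0 < k.+1`!%:R :> R by rewrite ltr0n fact_gt0.
rewrite ler_pdivrMr// in E.
rewrite [leLHS](_ : _ = s * s^-1 ^+ k.+1); last by rewrite exprS mulrA mulfV ?mul1r ?lt0r_neq0.
by rewrite [leRHS](_ : _ = s * (expR s^-1 * k.+1`!%:R)) ?ler_pM2l//; ring.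
Qed.

Lemma is_derive_flat k s :
  is_derive s (1 : R) (flat k) (flat k.+2 s - k%:R * flat k.+1 s).
Proof.
have [s0|s0|->] := ltgtP s 0.
- rewrite !flat_le0 ?ltW// mulr0 subr0.
  apply: (@near_eq_is_derive _ _ _ (cst 0)) => //.
  near=> y; rewrite flat_le0//; near: y.
  by apply: filterS (lt_nbhsl s0) => y /ltW.
(* For s > 0 the function is phi(1/s), a polynomial times an exponential in 1/s. *)
- pose phi (t : R) := t ^+ k * expR (- t).
  have dphi (t : R) : is_derive t (1 : R) phi (k%:R * t ^+ k.-1 * expR (- t) - t ^+ k * expR (- t)).
    have d1 : is_derive t (1 : R) (fun y : R => y ^+ k) (k%:R * t ^+ k.-1).
      by split; [exact: exprn_derivable|rewrite exp_derive /GRing.scale/= mulr1].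
    have d2 := is_derive1_comp (is_derive_expR (- t)) (is_deriveNid t (1 : R)).
    apply: is_derive_eq (is_deriveM d1 d2) _.
    by rewrite /GRing.scale/=; ring.
  have dV : is_derive s (1 : R) (fun y : R => y^-1) (- s ^- 2).
    by have := is_deriveV (lt0r_neq0 s0) (is_derive_id s (1 : R)); rewrite scaler1.
  have := is_derive1_comp (dphi s^-1) dV.
  rewrite (_ : _ * _ = flat k.+2 s - k%:R * flat k.+1 s); last first.
    rewrite /flat s0; case: k {phi dphi} => [|k] /=.
      by rewrite !mul0r; field; rewrite lt0r_neq0.
    by rewrite !exprVn !exprS; field; rewrite !expf_neq0 ?lt0r_neq0.
  apply: near_eq_is_derive; near=> y.
  have y0 : 0 < y by near: y; exact: lt_nbhsr.
  by rewrite /flat y0 /phi/= exprVn mulrC.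
- rewrite !flat_le0// mulr0 subr0.
  (* At 0 the difference quotient of [flat k] is [flat k.+1], which tends to 0 by
     [flat_le_linear]. *)
  have lim0 : (fun h => h^-1 *: ((flat k \o shift 0) (h *: (1 : R)) - flat k 0)) @ (0 : R)^' --> (0 : R).
    apply: cvg_trans (_ : flat k.+1 @ (0 : R)^' --> _).
      apply: near_eq_cvg; near=> h.
      rewrite /= [flat k 0]flat_le0// subr0 addr0 [_%:A]mulr1 /flat; case: ifP => h0; last by rewrite scaler0.
      by rewrite exprS invfM mulrCA.
    have f0 : flat k.+1 0 = 0 by rewrite flat_le0.
    apply/cvgrPdist_le => eps eps0.
    have C0 : 0 < k.+2`!%:R :> R by rewrite ltr0n fact_gt0.
    near=> h; rewrite sub0r normrN (le_trans (flat_le_linear _ _))//.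
    rewrite -ler_pdivlMl// mulrC; near: h.
    by apply: dnbhs0_le; rewrite divr_gt0.
  split; first by apply/cvg_ex; exists 0.
  exact: cvg_lim lim0.
Unshelve. all: by end_near. Qed.

Lemma Ck_flat k n : Ck n setT (flat k).
Proof.
have D j s : differentiable (flat j) s.
  by apply/derivable1_diffP; have [] := is_derive_flat j s.
have dE j (v : R) : 'D_v (flat j) = v \*: (flat j.+2 \+ (- j%:R) \*: flat j.+1).
  apply/funext => s; rewrite deriveE// -[v in LHS]mulr1 linearZ/= -deriveE//.
  by have [_ ->] := is_derive_flat j s; rewrite /GRing.scale/= mulNr.
elim: n k => [|n IH] k; split=> //; try by move=> x _; exact: differentiable_continuous.
move=> v; split=> [x _|]; first exact: diff_derivable.
by rewrite dE; apply: CkZ => //; [exact: openT|apply: CkD => //; [exact: openT|apply: CkZ => //; exact: openT]].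
Qed.
End flat.

(** * Charts and tangent vectors *)

Section Ck_derivative.
Context {R : realType} {V : normedModType R} {m n : nat}.
Variables (k : nat) (P : set 'rV[R]_n) (f : 'rV[R]_n -> 'rV[R]_m).
Hypotheses (oP : open P) (Cf : Ck k.+1 P f).

Let Cfi i : Ck k.+1 P (fun y => f y 0 i).
Proof. exact: (Ck_coord _ _ oP).1. Qed.

Lemma Ck_derive_linear a (c : R) v w : P a ->
  'D_(c *: v + w) f a = c *: 'D_v f a + 'D_w f a.
Proof.
move=> Pa; have d u : derivable f a u by exact: Ck_derivable Cf Pa.
apply/rowP => i; rewrite !(derive_mx (d _)) !mxE.
have D := Ck_differentiable oP Pa (Cfi i).
by rewrite !deriveE// linearP.
Qed.

Lemma is_derive_comp_Ck (h : V -> 'rV[R]_n) x v : P (h x) -> derivable h x v ->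
  is_derive x v (f \o h) ('D_('D_v h x) f (h x)).
Proof.
move=> Px dh; have d i : is_derive x v (fun y => f (h y) 0 i)
    ('D_('D_v h x) (fun y => f y 0 i) (h x)).
  have D := Ck_differentiable oP Px (Cfi i).
  by rewrite deriveE//; exact: (is_derive_comp (f := fun y => f y 0 i)).
have dfh : derivable (f \o h) x v.
  by apply/derivable_mxP => i j; rewrite ord1; have [] := d j.
split; first by [].
have df : derivable f (h x) ('D_v h x) by exact: Ck_derivable Cf Px.
apply/rowP => i; rewrite (derive_mx dfh) (derive_mx df) !mxE.
by have [_ <-] := d i.
Qed.

End Ck_derivative.

Section transitions.
Context {R : realType} {M : surface R}.
Implicit Types (phi psi chi : chart R M) (q : M) (x : 'rV[R]_2).

Lemma overlap_cmap phi psi q : cdom phi q -> cdom psi q -> overlap phi psi (cmap phi q).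
Proof. by move=> dp ds; split; [exact: cmap_cod|rewrite cmapK]. Qed.

Lemma overlap_open phi psi : open (overlap phi psi).
Proof.
rewrite openE => x [cx dx]; apply: filterI.
  by apply: open_nbhs_nbhs; split => //; exact: ccod_open.
apply: (cinv_continuous cx); apply: open_nbhs_nbhs; split => //.
exact: cdom_open.
Qed.

Lemma overlap_transition phi psi x : overlap phi psi x ->
  overlap psi phi (transition phi psi x).
Proof.
by move=> [cx dx]; split; [exact: cmap_cod|rewrite /transition/= cmapK//; exact: cinv_dom].
Qed.

Lemma transition_trans phi psi chi x : overlap phi chi x ->
  transition chi psi (transition phi chi x) = transition phi psi x.
Proof. by move=> [cx dx]; rewrite /transition/= cmapK. Qed.

Lemma transition_id phi x : ccod phi x -> transition phi phi x = x.
Proof. by move=> cx; rewrite /transition/= cinvK. Qed.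

Lemma near_ccod phi x : ccod phi x -> \forall y \near x, ccod phi y.
Proof. by move=> cx; apply: open_nbhs_nbhs; split => //; exact: ccod_open. Qed.

Lemma near_cdom phi q : cdom phi q -> \forall p \near q, cdom phi p.
Proof. by move=> dq; apply: open_nbhs_nbhs; split => //; exact: cdom_open. Qed.

Lemma near_cinv phi x (P : set M) : ccod phi x ->
  (\forall p \near cinv phi x, P p) -> \forall y \near x, P (cinv phi y).
Proof. by move=> /cinv_continuous; apply. Qed.

Lemma transition_derivable phi psi x w : atlas phi -> atlas psi ->
  overlap phi psi x -> derivable (transition phi psi) x w.
Proof.
by move=> ap as_ ox; exact: Ck_derivable (atlas_compat ap as_ 1) ox.
Qed.

Lemma derive_transition_linear phi psi x (c : R) v w : atlas phi -> atlas psi ->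
  overlap phi psi x -> 'D_(c *: v + w) (transition phi psi) x =
    c *: 'D_v (transition phi psi) x + 'D_w (transition phi psi) x.
Proof.
move=> ap as_; apply: Ck_derive_linear; first exact: overlap_open.
exact: (atlas_compat ap as_ 1).
Qed.

Lemma derive_transition_id phi x w : ccod phi x -> 'D_w (transition phi phi) x = w.
Proof.
move=> cx; rewrite -[RHS](derive_id x w); apply: near_eq_derive.
by apply: filterS (near_ccod cx) => y; exact: transition_id.
Qed.

(** The chain rule for the cocycle identity [transition_trans], which holds on the open set
    [overlap phi chi]. The comparison of tangent coordinates in different charts rests on it. *)
Lemma derive_transition_trans phi psi chi x w :
  atlas phi -> atlas psi -> atlas chi -> overlap phi psi x -> overlap phi chi x ->
  'D_('D_w (transition phi chi) x) (transition chi psi) (transition phi chi x) =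
  'D_w (transition phi psi) x.
Proof.
move=> ap as_ ac ops opc.
have Px : overlap chi psi (transition phi chi x).
  split; first by case: (overlap_transition opc).
  by rewrite /transition/= cmapK; case: opc ops => ? ? [].
have [_ <-] := is_derive_comp_Ck (@overlap_open chi psi) (atlas_compat ac as_ 1) Px
  (transition_derivable (w := w) ap ac opc).
apply: near_eq_derive; near=> y; apply: transition_trans.
by near: y; apply: open_nbhs_nbhs; split => //; exact: overlap_open.
Unshelve. all: by end_near. Qed.

(** The inverse of [of_chart phi q] for [phi] in the atlas and [q] in its domain: the coordinates in
    [phi] of a tangent vector at [q]. *)
Definition to_chart phi q (v : 'rV[R]_2) : 'rV[R]_2 :=
  'D_v (transition (chart_at q) phi) (cmap (chart_at q) q).

Lemma to_chart_linear phi q (c : R) v w : atlas phi -> cdom phi q ->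
  to_chart phi q (c *: v + w) = c *: to_chart phi q v + to_chart phi q w.
Proof.
move=> ap dq; apply: derive_transition_linear => //; first exact: chart_at_atlas.
by apply: overlap_cmap => //; exact: chart_at_dom.
Qed.

Lemma of_chart_linear phi q (c : R) v w : atlas phi -> cdom phi q ->
  of_chart phi q (c *: v + w) = c *: of_chart phi q v + of_chart phi q w.
Proof.
move=> ap dq; apply: derive_transition_linear => //; first exact: chart_at_atlas.
by apply: overlap_cmap => //; exact: chart_at_dom.
Qed.

Lemma of_chart0 phi q : of_chart phi q 0 = 0.
Proof. exact: derive0. Qed.

Lemma of_chartB phi q v w : atlas phi -> cdom phi q ->
  of_chart phi q (v - w) = of_chart phi q v - of_chart phi q w.
Proof.
by move=> ap dq; rewrite -[v - w]addrC -scaleN1r of_chart_linear// scaleN1r addrC.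
Qed.

Lemma of_chart_at q v : of_chart (chart_at q) q v = v.
Proof. by apply: derive_transition_id; apply: cmap_cod; exact: chart_at_dom. Qed.

(** The preferred chart at [q], which may jump with [q], cancels out. What remains is the derivative
    of a fixed transition map, which is smooth. *)
Lemma to_of_chart phi psi q v : atlas phi -> atlas psi -> cdom phi q -> cdom psi q ->
  to_chart psi q (of_chart phi q v) = 'D_v (transition phi psi) (cmap phi q).
Proof.
move=> ap as_ dp ds; rewrite -(@derive_transition_trans phi psi (chart_at q))//.
- by rewrite /to_chart /of_chart /transition/= cmapK.
- exact: chart_at_atlas.
- exact: overlap_cmap.
- by apply: overlap_cmap => //; exact: chart_at_dom.
Qed.

Lemma of_to_chart phi q v : atlas phi -> cdom phi q ->
  of_chart phi q (to_chart phi q v) = v.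
Proof.
move=> ap dp; have dq := chart_at_dom q; have aq := chart_at_atlas q.
rewrite -[RHS](@derive_transition_id (chart_at q) (cmap (chart_at q) q)); last exact: cmap_cod.
rewrite -(@derive_transition_trans (chart_at q) (chart_at q) phi)//;
  try exact: overlap_cmap.
by rewrite /of_chart /to_chart /transition/= cmapK.
Qed.

Lemma of_chart_trans phi psi q v : atlas phi -> atlas psi -> cdom phi q -> cdom psi q ->
  of_chart psi q ('D_v (transition phi psi) (cmap phi q)) = of_chart phi q v.
Proof. by move=> ap as_ dp ds; rewrite -to_of_chart// of_to_chart. Qed.

End transitions.

(** * Bump functions *)

Section bump.
Context {R : realType}.

(** The squared Euclidean norm; the norm of ['rV] is a maximum of coordinates and is not smooth. *)
Definition sqnorm (z : 'rV[R]_2) : R := \sum_i z 0 i ^+ 2.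

Lemma sqnorm_ge0 z : 0 <= sqnorm z.
Proof. by apply: sumr_ge0 => i _; rewrite sqr_ge0. Qed.

Lemma sqnorm0 : sqnorm 0 = 0.
Proof. by apply: big1 => i _; rewrite mxE expr0n. Qed.

Lemma sqnormZ (c : R) z : sqnorm (c *: z) = c ^+ 2 * sqnorm z.
Proof. by rewrite /sqnorm mulr_sumr; apply: eq_bigr => i _; rewrite mxE exprMn. Qed.

Lemma coord_le_sqnorm z (r : R) i : 0 <= r -> sqnorm z <= r ^+ 2 -> `|z 0 i| <= r.
Proof.
move=> r0 zr; rewrite -(@ler_pXn2r _ 2)// ?nnegrE// -normrX ger0_norm ?sqr_ge0//.
apply: le_trans zr; rewrite /sqnorm (bigD1 i)//= lerDl.
by apply: sumr_ge0 => j _; rewrite sqr_ge0.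
Qed.

Lemma Ck_sqnorm n (z0 : 'rV[R]_2) : Ck n setT (fun z => sqnorm (z - z0)).
Proof.
have oT : open [set: 'rV[R]_2] := openT.
have Cid : Ck n setT (idfun : 'rV[R]_2 -> 'rV[R]_2) by apply: Ck_linear => x; exact: cvg_id.
apply: Ck_sum => // i; have Ci : Ck n setT (fun z : 'rV[R]_2 => (z - z0) 0 i).
  by apply: (Ck_coord _ _ oT).1; apply: CkD => //; exact: Ck_cst.
by have := CkM oT Ci Ci.
Qed.

Definition radial_bump (z0 : 'rV[R]_2) (r : R) (z : 'rV[R]_2) : R :=
  flat 0 (r ^+ 2 - sqnorm (z - z0)) / flat 0 (r ^+ 2).

Lemma Ck_radial_bump n z0 r : Ck n setT (radial_bump z0 r).
Proof.
have oT : open [set: 'rV[R]_2] := openT.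
apply: CkM => //; last exact: Ck_cst.
apply: (@Ck_comp_real _ _ _ _ setT (flat 0)) => //; [exact: openT|exact: Ck_flat|].
apply: CkD => //; first exact: Ck_cst.
by have := CkZ (-1) oT (Ck_sqnorm n z0); apply: Ck_eq => // z _; rewrite /= scaleN1r.
Qed.

Variables (z0 : 'rV[R]_2) (r : R).
Hypothesis r0 : 0 < r.

Let r2 : 0 < r ^+ 2. Proof. by rewrite exprn_gt0. Qed.

Lemma radial_bump_ge0 z : 0 <= radial_bump z0 r z.
Proof. by rewrite divr_ge0 ?flat_ge0. Qed.

Lemma radial_bump_le1 z : radial_bump z0 r z <= 1.
Proof.
by rewrite ler_pdivrMr ?flat_gt0// mul1r flat0_le// gerBl sqnorm_ge0.
Qed.

Lemma radial_bump_center : radial_bump z0 r z0 = 1.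
Proof. by rewrite /radial_bump subrr sqnorm0 subr0 divff// gt_eqF// flat_gt0. Qed.

Lemma radial_bump_gt0 z : (0 < radial_bump z0 r z) = (sqnorm (z - z0) < r ^+ 2).
Proof. by rewrite pmulr_lgt0 ?invr_gt0 ?flat_gt0// subr_gt0. Qed.

Context {M : surface R}.
Implicit Types (phi psi : chart R M) (q p : M).

Definition smooth_fun (f : M -> R) : Prop :=
  forall psi, atlas psi -> smooth_on (ccod psi) (f \o cinv psi).

(** Extension by zero, since [cmap] carries no meaning outside [cdom]. *)
Definition chart_bump phi q : R :=
  if `[< cdom phi q >] then radial_bump z0 r (cmap phi q) else 0.

Lemma chart_bump_in phi q : cdom phi q -> chart_bump phi q = radial_bump z0 r (cmap phi q).
Proof. by move=> dq; rewrite /chart_bump asboolT. Qed.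

Lemma chart_bump_out phi q : ~ cdom phi q -> chart_bump phi q = 0.
Proof. by move=> dq; rewrite /chart_bump asboolF. Qed.

Lemma chart_bump_ge0 phi q : 0 <= chart_bump phi q.
Proof. by rewrite /chart_bump; case: ifP => // _; exact: radial_bump_ge0. Qed.

Lemma chart_bump_le1 phi q : chart_bump phi q <= 1.
Proof. by rewrite /chart_bump; case: ifP => // _; exact: radial_bump_le1. Qed.

Variable phi : chart R M.
Hypotheses (aphi : atlas phi).
Hypothesis sub : forall z : 'rV[R]_2, (forall i, `|z 0 i - z0 0 i| <= r) -> ccod phi z.

(** The bump is positive only on the image under [cinv phi] of a closed box in [ccod phi]. This
    image is compact, hence closed because the surface is Hausdorff, and its complement is a
    neighbourhood of [q]. *)
Lemma chart_bump_near0 q : ~ cdom phi q -> \forall p \near q, chart_bump phi p = 0.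
Proof.
move=> dq; pose K0 := [set z : 'rV[R]_2 | forall i, `[z0 0 i - r, z0 0 i + r]%classic (z 0 i)].
have K0P z : K0 z <-> forall i, `|z 0 i - z0 0 i| <= r.
  by split=> H i; have := H i; rewrite /= in_itv/= ler_distl.
have cK0 : compact K0.
  apply: (@rV_compact _ _ (fun i => `[z0 0 i - r, z0 0 i + r]%classic)) => i.
  exact: segment_compact.
have cK : closed (cinv phi @` K0).
  apply: compact_closed; first exact: surface_hausdorff.
  apply: continuous_compact => //; apply: continuous_in_subspaceT => z.
  by rewrite inE => /K0P/sub; exact: cinv_continuous.
have nK : ~ (cinv phi @` K0) q by move=> [z /K0P/sub cz E]; apply: dq; rewrite -E; exact: cinv_dom.
have : \forall p \near q, ~ (cinv phi @` K0) p.
  by apply: open_nbhs_nbhs; split => //; exact: closed_openC.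
apply: filterS => p nKp; have [dp|/chart_bump_out//] := pselect (cdom phi p).
apply/eqP; rewrite eq_le chart_bump_ge0 andbT leNgt chart_bump_in// radial_bump_gt0; apply/negP => s.
apply: nKp; exists (cmap phi p); last exact: cmapK.
apply/K0P => i; have := coord_le_sqnorm i (ltW r0) (ltW s).
by rewrite !mxE.
Qed.

Lemma smooth_bump : smooth_fun (chart_bump phi).
Proof.
move=> psi apsi n; apply: Ck_local => x cx.
have [dx|dx] := pselect (cdom phi (cinv psi x)).
  exists (overlap psi phi); first by [].
  have oO := @overlap_open R M psi phi.
  have := @Ck_comp_rV _ _ _ n _ setT _ _ oO openT (fun _ _ => I)
    (Ck_radial_bump n z0 r) (atlas_compat apsi aphi n).
  by apply: Ck_eq => // y; rewrite inE => -[cy dy]; rewrite /= chart_bump_in.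
have nx := near_cinv cx (chart_bump_near0 dx).
exists (interior [set y | chart_bump phi (cinv psi y) = 0]); first exact: nx.
apply: Ck_eq (Ck_cst _ _ 0); first exact: open_interior.
by move=> y; rewrite inE => /interior_subset.
Qed.

End bump.

(** * Riemannian metrics *)

Section dot.
Context {R : realType}.
Implicit Types u v w : 'rV[R]_2.

Definition dot u v : R := \sum_j u 0 j * v 0 j.

Lemma dotC u v : dot u v = dot v u.
Proof. by apply: eq_bigr => j _; rewrite mulrC. Qed.

Lemma dot_linear u (c : R) v w : dot u (c *: v + w) = c * dot u v + dot u w.
Proof.
rewrite /dot mulr_sumr -big_split/=; apply: eq_bigr => j _.
by rewrite !mxE; ring.
Qed.

Lemma dot_ge0 v : 0 <= dot v v.
Proof. by apply: sumr_ge0 => j _; rewrite -expr2 sqr_ge0. Qed.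

Lemma dot_gt0 v : v != 0 -> 0 < dot v v.
Proof.
move=> v0; rewrite lt_neqAle dot_ge0 andbT eq_sym; apply: contra v0.
rewrite psumr_eq0; last by move=> j _; rewrite -expr2 sqr_ge0.
move=> /allP H; apply/eqP/rowP => j; rewrite mxE.
by have := H j (mem_index_enum _); rewrite /= mulf_eq0 orbb => /eqP.
Qed.

End dot.

Section patched_metric.
Context {R : realType} {M : surface R}.
Variables (I : eqType) (s : seq I) (F : I -> chart R M) (chi : I -> M -> R).
Hypothesis aF : forall i, atlas (F i).
Hypothesis chi_smooth : forall i, smooth_fun (chi i).
Hypothesis chi_ge0 : forall i q, 0 <= chi i q.
Hypothesis chi_out : forall i q, ~ cdom (F i) q -> \forall p \near q, chi i p = 0.
Hypothesis chi_pos : forall q, exists2 i, i \in s & 0 < chi i q.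

(** Pullbacks of the Euclidean product, weighted without normalising to a partition of unity: one
    positive weight at each point makes the sum definite. *)
Definition patched_metric q v w : R :=
  \sum_(i <- s) chi i q * dot (to_chart (F i) q v) (to_chart (F i) q w).

Lemma patched_metric_riemannian : riemannian_metric patched_metric.
Proof.
split.
- move=> q v b w1 w2; rewrite /patched_metric mulr_sumr -big_split/=.
  apply: eq_bigr => i _; have [dq|/chi_out/nbhs_singleton->] := pselect (cdom (F i) q).
    by rewrite to_chart_linear// dot_linear; move: (dot _ _) (dot _ _) => d1 d2; ring.
  by move: (dot _ _) (dot _ _) (dot _ _) => d1 d2 d3; ring.
- by move=> q v w; apply: eq_bigr => i _; rewrite dotC.
- move=> q v v0; have [i si ci] := chi_pos q.
  rewrite /patched_metric (big_rem i)//= ltr_pwDl//; last first.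
    by apply: sumr_ge0 => j _; rewrite mulr_ge0// dot_ge0.
  have dq : cdom (F i) q.
    by have [//|/chi_out/nbhs_singleton H] := pselect (cdom (F i) q); rewrite H ltxx in ci.
  (* A nonzero vector has nonzero coordinates, because [of_chart] is a left inverse of
     [to_chart]. *)
  rewrite mulr_gt0// dot_gt0//; apply: contra_neq v0 => v0.
  by rewrite -(of_to_chart v (aF i) dq) v0 of_chart0.
move=> psi apsi w1 w2 n; apply: Ck_sum => [|i]; first exact: ccod_open.
apply: Ck_local => x cx; have [dx|dx] := pselect (cdom (F i) (cinv psi x)).
  exists (overlap psi (F i)); first by [].
  have oO := @overlap_open R M psi (F i).
  have CD w : Ck n (overlap psi (F i)) ('D_w (transition psi (F i))).
    exact: Ck_derive (atlas_compat apsi (aF i) n.+1).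
  have CDj w j := (Ck_coord _ _ oO).1 (CD w) j.
  have Cchi : Ck n (overlap psi (F i)) (chi i \o cinv psi).
    by apply: Ck_sub (chi_smooth i apsi n) => y [].
  have Cdot : Ck n (overlap psi (F i)) (fun y =>
      dot ('D_w1 (transition psi (F i)) y) ('D_w2 (transition psi (F i)) y)).
    by apply: Ck_sum => // j; apply: CkM.
  apply: Ck_eq oO _ (CkM oO Cchi Cdot) => y; rewrite inE => -[cy dy] /=.
  by rewrite !to_of_chart ?cinvK//; exact: cinv_dom.
have nx := near_cinv cx (chi_out dx).
exists (interior [set y | chi i (cinv psi y) = 0]); first exact: nx.
apply: Ck_eq (Ck_cst _ _ 0); first exact: open_interior.
by move=> y; rewrite inE => /interior_subset /= ->; rewrite mul0r.
Qed.

End patched_metric.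

Section existence.
Context {R : realType} {M : surface R}.

Lemma smooth_fun_continuous (f : M -> R) : smooth_fun f -> continuous f.
Proof.
move=> sf q; have dq := chart_at_dom q.
have cc := Ck_continuous (sf _ (chart_at_atlas q) 0%N) (cmap_cod dq).
have := continuous_comp (cmap_continuous dq) cc.
rewrite {1}/prop_for /continuous_at /= cmapK// => cf.
apply: cvg_trans cf; apply: near_eq_cvg.
by apply: filterS (near_cdom dq) => p dp; rewrite /= cmapK.
Qed.

Lemma ccod_radius (phi : chart R M) z0 : ccod phi z0 ->
  exists2 r : R, 0 < r & forall z : 'rV[R]_2, (forall i, `|z 0 i - z0 0 i| <= r) -> ccod phi z.
Proof.
move=> cz; have [e /= e0 se] := (nbhs_ballP _ _).1 (near_ccod cz).
(* Halving the radius puts the closed box inside the open ball. *)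
exists (e / 2); first by rewrite divr_gt0.
move=> z zr; apply: se; rewrite -ball_normE/= distrC.
apply: (@le_lt_trans _ _ (e / 2)); last by rewrite ltr_pdivrMr// ltr_pMr// ltr1n.
by apply: rV_norm_le => [|i]; [rewrite ltW// divr_gt0|rewrite !mxE].
Qed.

(** By compactness finitely many of the bumps centred at points of the surface have no common zero,
    and they serve as weights. *)
Lemma riemannian_metric_exists (x0 : M) : compact [set: M] ->
  exists g : M -> 'rV[R]_2 -> 'rV[R]_2 -> R, riemannian_metric g.
Proof.
move=> cM; pose z0 (p : M) := cmap (chart_at p) p.
have cz0 p : ccod (chart_at p) (z0 p) by apply: cmap_cod; exact: chart_at_dom.
have /choice [r rP] : forall p, exists r : R, 0 < r /\
    forall z : 'rV[R]_2, (forall i, `|z 0 i - z0 p 0 i| <= r) -> ccod (chart_at p) z.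
  by move=> p; have [r r0 rs] := ccod_radius (cz0 p); exists r.
pose chi p := chart_bump (z0 p) (r p) (chart_at p).
have r0 p : 0 < r p by have [] := rP p.
have rs p := (rP p).2.
have schi p : smooth_fun (chi p) := smooth_bump (r0 p) (@chart_at_atlas _ _ p) (rs p).
(* [cover_compact] is used on a pointed space, and [x0] provides the point. *)
pose pointM := isPointed.Build M x0.
pose pM : ptopologicalType := HB.pack (carrier M) pointM.
have cM' : @cover_compact pM setT by rewrite -(compact_cover pM).
have [||D _ cD] := cM' M setT (fun p => [set q | 0 < chi p q]).
- move=> p _; rewrite (_ : [set q | _] = chi p @^-1` [set t : R | 0 < t]) //.
  by apply: open_comp; [move=> q _; exact: smooth_fun_continuous|exact: open_gt].
- move=> q _; exists q => //=; rewrite /chi chart_bump_in; last exact: chart_at_dom.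
  by rewrite radial_bump_center.
exists (patched_metric (finmap.enum_fset D) (fun p => chart_at p) chi); apply: patched_metric_riemannian => //.
- by move=> p; exact: chart_at_atlas.
- by move=> p q; exact: chart_bump_ge0.
- by move=> p q dq; apply: (chart_bump_near0 (r0 p) _ dq); exact: rs.
- by move=> q; have [p Dp pq] := cD q I; exists p.
Qed.

End existence.

(** Lagrangians quadratic on the fibres restrict to quadratic polynomials on lines, so fibre
    derivatives are read off as linear coefficients. *)
Lemma is_derive_quadratic {R : realType} {V : normedModType R} (f : V -> R) x v (b c : R) :
  (forall h : R, f (h *: v + x) = f x + h * b + h ^+ 2 * c) -> is_derive x v f b.
Proof.
move=> H.
have lim : (fun h : R => h^-1 *: ((f \o shift x) (h *: v) - f x)) @ (0 : R)^' --> b.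
  apply: cvg_trans (_ : (fun h : R => b + h * c) @ (0 : R)^' --> _).
    apply: near_eq_cvg; near=> h.
    have h0 : h != 0 by near: h; exact: nbhs_dnbhs_neq.
    by rewrite /= H /GRing.scale/=; field.
  have : (fun h : R => b + h * c) @ (0 : R) --> b + 0 * c.
    by apply: cvgD; [exact: cvg_cst|apply: cvgM; [exact: cvg_id|exact: cvg_cst]].
  by rewrite mul0r addr0; exact: cvg_within_filter.
by split; [apply/cvg_ex; exists b|exact: cvg_lim lim].
Unshelve. all: by end_near. Qed.

Lemma sup_max {R : realType} (A : set R) (m : R) : A m -> ubound A m -> sup A = m.
Proof.
move=> Am ub; apply/eqP; rewrite eq_le; apply/andP; split.
  by apply: ge_sup => //; exists m.
by apply: ub_le_sup => //; exists m.
Qed.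

Lemma big_ord2 (V : nmodType) (F : 'I_2 -> V) : \sum_i F i = F 0 + F 1.
Proof. by rewrite big_ord_recl big_ord1; congr (_ + F _); exact: val_inj. Qed.

(** The Gram matrix in the coordinates of [chart_at q]. It serves for algebra at one point and need
    not depend smoothly on [q]. *)
Definition metric_coef {R : realType} {M : surface R}
    (g : M -> 'rV[R]_2 -> 'rV[R]_2 -> R) q (i j : 'I_2) : R :=
  g q (delta_mx 0 i) (delta_mx 0 j).

(** * Linear algebra of the inner product on one tangent space *)

Section metric_at_a_point.
Context {R : realType} {M : surface R}.
Variable g : M -> 'rV[R]_2 -> 'rV[R]_2 -> R.
Hypothesis hg : riemannian_metric g.
Implicit Types (q : M) (u v w : 'rV[R]_2).

Local Notation e := (delta_mx (0 : 'I_1)).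

Lemma rV2_sum v : v = v 0 0 *: e 0 + v 0 1 *: e 1.
Proof. by rewrite {1}(row_sum_delta v) big_ord2. Qed.

(** Turns identities between values of [g] into polynomial identities in coordinates. *)
Lemma metricE q v w : g q v w =
  metric_coef g q 0 0 * (v 0 0 * w 0 0) +
  metric_coef g q 0 1 * (v 0 0 * w 0 1 + v 0 1 * w 0 0) +
  metric_coef g q 1 1 * (v 0 1 * w 0 1).
Proof.
have [gl gs _ _] := hg.
have g0 u : g q u 0 = 0 by have := gl q u (-1) 0 0; rewrite scaler0 addr0 mulN1r addNr.
have gZ u (c : R) w' : g q u (c *: w') = c * g q u w'.
  by rewrite -[c *: w']addr0 gl g0 addr0.
rewrite (rV2_sum w) gl gZ (gs q v) (gs q v) (rV2_sum v) !gl !gZ (gs q (e 1) (e 0)).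
by rewrite /metric_coef !mxE/=; ring.
Qed.

(** Smoothness of a metric is given for fixed coordinate vectors; this expansion transfers it to
    variable ones, with [A] the map [of_chart] at a point. *)
Lemma metric_pullback q (A : 'rV[R]_2 -> 'rV[R]_2) v :
  (forall (c : R) u w, A (c *: u + w) = c *: A u + A w) ->
  g q (A v) (A v) = g q (A (e 0)) (A (e 0)) * (v 0 0 * v 0 0) +
    (2 * (g q (A (e 0)) (A (e 1)) * (v 0 0 * v 0 1)) +
     g q (A (e 1)) (A (e 1)) * (v 0 1 * v 0 1)).
Proof.
move=> lin; have A0 : A 0 = 0.
  by have := lin (-1) 0 0; rewrite scaler0 addr0 scaleN1r addNr.
have -> : A v = v 0 0 *: A (e 0) + v 0 1 *: A (e 1).
  by rewrite {1}(rV2_sum v) lin -[_ *: e 1]addr0 lin A0 addr0.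
move: (A (e 0)) (A (e 1)) => a b.
by rewrite (metricE _ a a) (metricE _ a b) (metricE _ b b) metricE !mxE; ring.
Qed.

Lemma metric_gt0 q v : v != 0 -> 0 < g q v v.
Proof. by case: hg => _ _ + _; apply. Qed.

Lemma metric_ge0 q v : 0 <= g q v v.
Proof.
have [->|/metric_gt0/ltW//] := eqVneq v 0.
by rewrite metricE !mxE !(mulr0, mul0r, addr0).
Qed.

Let det q := metric_coef g q 0 0 * metric_coef g q 1 1 - metric_coef g q 0 1 ^+ 2.

Lemma metric_coef_gt0 q (i : 'I_2) : 0 < metric_coef g q i i.
Proof.
apply: metric_gt0; apply/eqP => /rowP/(_ i); rewrite !mxE !eqxx/= => /eqP.
by rewrite oner_eq0.
Qed.

Lemma metric_det_gt0 q : 0 < det q.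
Proof.
(* This vector is orthogonal to the first basis vector, and its square is the first diagonal
   coefficient times the determinant. *)
pose v : 'rV[R]_2 := (- metric_coef g q 0 1) *: e 0 + metric_coef g q 0 0 *: e 1.
have v1 : v 0 1 = metric_coef g q 0 0 by rewrite !mxE/= mulr0 add0r mulr1.
have v0 : v 0 0 = - metric_coef g q 0 1 by rewrite !mxE/= mulr0 addr0 mulr1.
have a0 := metric_coef_gt0 q 0.
have : 0 < g q v v.
  apply: metric_gt0; apply/eqP => /rowP/(_ 1); rewrite v1 mxE => E.
  by rewrite E ltxx in a0.
rewrite metricE v0 v1.
rewrite (_ : _ + _ = metric_coef g q 0 0 * det q); last by rewrite /det; ring.
by rewrite pmulr_rgt0.
Qed.

(** Lagrange's identity: the difference of the two sides is the Gram determinant times the square of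
    the determinant of [v] and [w]. *)
Lemma metric_cauchy_schwarz q v w : g q v w ^+ 2 <= g q v v * g q w w.
Proof.
rewrite -subr_ge0 !(metricE q).
rewrite [leRHS](_ : _ = det q * (v 0 0 * w 0 1 - v 0 1 * w 0 0) ^+ 2); last by rewrite /det; ring.
by rewrite mulr_ge0 ?sqr_ge0// ltW// metric_det_gt0.
Qed.

Lemma norm_le_sqnorm v : `|v| ^+ 2 <= sqnorm v.
Proof.
rewrite -(sqr_sqrtr (sqnorm_ge0 v)) ler_pXn2r ?nnegrE// ?sqrtr_ge0//.
apply: rV_norm_le => [|i]; first exact: sqrtr_ge0.
by apply: coord_le_sqnorm; rewrite ?sqrtr_ge0// sqr_sqrtr// sqnorm_ge0.
Qed.

(** The constant is determinant over trace. By Cayley-Hamilton for the Gram matrix A, tr(A) g(v, v)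
    - det(A) |v|^2 = |A v|^2 in the Euclidean norm, which is nonnegative. *)
Lemma metric_coercive q : exists2 k : R, 0 < k & forall v, k * `|v| ^+ 2 <= g q v v.
Proof.
set a := metric_coef g q 0 0; set c := metric_coef g q 1 1; set b := metric_coef g q 0 1.
have ac : 0 < a + c by rewrite addr_gt0 ?metric_coef_gt0.
exists (det q / (a + c)); first by rewrite divr_gt0 ?metric_det_gt0.
move=> v; apply: (@le_trans _ _ (det q / (a + c) * sqnorm v)).
  by rewrite ler_wpM2l ?norm_le_sqnorm// ltW// divr_gt0 ?metric_det_gt0.
rewrite mulrAC ler_pdivrMr// -subr_ge0.
rewrite metricE -/a -/b -/c /sqnorm big_ord2.
rewrite [leRHS](_ : _ = (a * v 0 0 + b * v 0 1) ^+ 2 + (b * v 0 0 + c * v 0 1) ^+ 2).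
  by rewrite addr_ge0// sqr_ge0.
by rewrite /det -/a -/b -/c; ring.
Qed.

Lemma gnorm_sqr q v : Defs.gnorm g q v ^+ 2 = g q v v.
Proof. by rewrite sqr_sqrtr// metric_ge0. Qed.

(** Cauchy-Schwarz gives the upper bound, attained at [u] divided by its norm, or at 0 if that norm
    vanishes. *)
Lemma dual_norm_metric q u : dual_norm g q (g q u) = Defs.gnorm g q u.
Proof.
have n0 : 0 <= Defs.gnorm g q u by exact: sqrtr_ge0.
apply: sup_max; last first.
  move=> _ [v /= v1 <-].
  rewrite -(@ler_pXn2r _ 2)// ?nnegrE// -normrX ger0_norm ?sqr_ge0//.
  apply: le_trans (metric_cauchy_schwarz q u v) _.
  rewrite -!gnorm_sqr ler_piMr ?sqr_ge0// expr_le1//; exact: sqrtr_ge0.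
have [u0|u0] := eqVneq (Defs.gnorm g q u) 0.
  exists 0; rewrite /= ?u0.
    by rewrite /Defs.gnorm metricE !mxE !(mulr0, mul0r, addr0) sqrtr0.
  by rewrite metricE !mxE !(mulr0, mul0r, addr0) normr0.
have E (c : R) w v : g q w (c *: v) = c * g q w v by rewrite !(metricE q) !mxE; ring.
have E' (c : R) w v : g q (c *: w) v = c * g q w v by rewrite !(metricE q) !mxE; ring.
set n := Defs.gnorm g q u in n0 u0 *.
have G1 : g q (n^-1 *: u) (n^-1 *: u) = 1 by rewrite E E' -gnorm_sqr -/n; field.
exists (n^-1 *: u); first by rewrite /= /Defs.gnorm G1 sqrtr1.
by rewrite E -gnorm_sqr -/n expr2 mulKf// ger0_norm.
Qed.

End metric_at_a_point.

(** * Lagrangians with drift *)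

Section drift_lagrangian.
Context {R : realType} {M : surface R}.
Variables (g : M -> 'rV[R]_2 -> 'rV[R]_2 -> R) (X : M -> 'rV[R]_2) (W : M -> R).
Hypothesis hg : riemannian_metric g.
Implicit Types (q : M) (u v w : 'rV[R]_2).

Local Notation e := (delta_mx (0 : 'I_1)).
Local Notation mE := (metricE hg).

Definition drift_lagrangian q v : R := 2^-1 * g q (v - X q) (v - X q) - W q.
Local Notation L := drift_lagrangian.

Lemma dvL_drift q v w : dvL L q v w = g q (v - X q) w.
Proof.
suff [_ //] : is_derive v w (L q) (g q (v - X q) w).
apply: (is_derive_quadratic (c := 2^-1 * g q w w)) => h.
by rewrite /L (mE _ w w) (mE _ _ w) (mE _ (v - X q) (v - X q)) mE !mxE; field.
Qed.

Lemma dvvL_drift q v w : dvvL L q v w = g q w w.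
Proof.
rewrite /dvvL (_ : (fun v' => _) = fun v' => g q (v' - X q) w); last first.
  by apply/funext => v'; rewrite -dvL_drift.
suff [_ //] : is_derive v w (fun v' => g q (v' - X q) w) (g q w w).
apply: (is_derive_quadratic (c := 0)) => h.
by rewrite (mE _ w w) (mE _ (v - X q) w) mE !mxE; ring.
Qed.

Lemma energy_drift q v :
  energy L q v = 2^-1 * g q v v - 2^-1 * g q (X q) (X q) + W q.
Proof.
rewrite /energy dvL_drift /L (mE _ (v - X q) v) (mE _ (v - X q) (v - X q)).
by rewrite (mE _ v v) (mE _ (X q) (X q)) !mxE; field.
Qed.

(** Completing the square: g(u, v) - L(q, v) is the stated value minus |v - X - u|^2 / 2, so the
    maximum is at v = X + u. *)
Lemma hamiltonian_drift q u :
  hamiltonian L q (g q u) = g q (X q) u + 2^-1 * g q u u + W q.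
Proof.
have E v : g q u v - L q v = g q (X q) u + 2^-1 * g q u u + W q
    - 2^-1 * g q (v - X q - u) (v - X q - u).
  rewrite /L (mE _ u v) (mE _ (v - X q) (v - X q)) (mE _ (X q) u) (mE _ u u).
  by rewrite (mE _ (v - X q - u)) !mxE; field.
apply: sup_max.
  exists (X q + u) => //; rewrite E (_ : X q + u - X q - u = 0).
    by rewrite [X in _ - 2^-1 * X]mE !mxE; ring.
  by apply/rowP => i; rewrite !mxE; ring.
move=> _ [v _ <-]; rewrite E gerBl mulr_ge0//; exact: metric_ge0.
Qed.

Lemma hamiltonian_drift0 q : hamiltonian L q (fun=> 0) = W q.
Proof.
rewrite -[RHS](_ : g q (X q) 0 + 2^-1 * g q 0 0 + W q = _).
  by rewrite -hamiltonian_drift; congr hamiltonian; apply/funext => v; rewrite mE !mxE; ring.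
by rewrite (mE _ 0) (mE _ _ 0) !mxE; ring.
Qed.

(** For a = 1/2 the convexity bound is an equality, and this is also the value prescribed for
    magnetic Lagrangians. *)
Lemma drift_admissible : admissible g L 2^-1.
Proof.
split=> [|q v w|//]; first by rewrite invr_gt0.
by rewrite dvvL_drift gnorm_sqr// mulfV ?mul1r// pnatr_eq0.
Qed.

Lemma theta_drift q : theta L q = g q (- X q).
Proof. by apply/funext => w; rewrite /theta dvL_drift sub0r. Qed.

Lemma dual_theta_drift q : dual_norm g q (theta L q) ^+ 2 = g q (X q) (X q).
Proof.
rewrite theta_drift dual_norm_metric// gnorm_sqr//.
by rewrite (mE _ (- X q)) (mE _ (X q)) !mxE; ring.
Qed.

Lemma drift_superlinear q (K : R) :
  exists r : R, forall v, r < `|v| -> K * `|v| <= L q v.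
Proof.
have [k k0 gk] := metric_coercive hg q.
(* With t = |v| - c one has |v - X| >= t, so L >= k t^2 / 2 - W. Once t >= 1, K |v| + W <= B t, and
   t >= 2 B / k makes this at most k t^2 / 2. *)
set c := `|X q|; pose B := `|K| + `|K| * c + `|W q|.
have c0 : 0 <= c by exact: normr_ge0.
have B0 : 0 <= B by rewrite !addr_ge0// mulr_ge0.
exists (c + 1 + 2 * B / k) => v vr.
pose t := `|v| - c.
have tB : 1 + 2 * B / k < t by rewrite /t; lra.
have t1 : 1 <= t by apply: le_trans (ltW tB); rewrite lerDl divr_ge0 ?mulr_ge0// ltW.
have t0 : 0 <= t by apply: le_trans t1.
have kt : B <= 2^-1 * k * t.
  have : 2 * B / k <= t by apply: le_trans (ltW tB); rewrite lerDr.
  by rewrite ler_pdivrMr// => H; lra.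
have tv : t <= `|v - X q| by rewrite /t lerBlDr -{1}(subrK (X q) v) ler_normD.
have gt : k * t ^+ 2 <= g q (v - X q) (v - X q).
  apply: le_trans (gk _); rewrite ler_wpM2l ?(ltW k0)//.
  by rewrite ler_pXn2r// nnegrE.
have Bt : B * t <= 2^-1 * (k * t ^+ 2).
  by rewrite [leRHS](_ : _ = 2^-1 * k * t * t) ?ler_wpM2r//; ring.
rewrite /L lerBrDr; apply: (@le_trans _ _ (2^-1 * (k * t ^+ 2))); last first.
  by rewrite ler_wpM2l// invr_ge0.
apply: le_trans Bt.
have vE : `|v| = t + c by rewrite /t subrK.
have K1 : K * `|v| <= `|K| * t + `|K| * c.
  by rewrite vE mulrDr lerD// ler_wpM2r// ?ler_norm//; exact: normr_ge0.
have K2 : `|K| * c <= `|K| * c * t by rewrite ler_peMr// mulr_ge0.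
have K3 : W q <= `|W q| * t.
  by apply: le_trans (ler_norm _) _; rewrite ler_peMr.
by rewrite /B !mulrDl; lra.
Qed.

(** The values of [X] are coordinates in preferred charts, which may jump from point to point;
    smoothness is therefore asked of the coordinates [xi] in a fixed chart. *)
Definition smooth_field : Prop := forall psi, atlas psi ->
  exists xi : 'rV[R]_2 -> 'rV[R]_2, smooth_on (ccod psi) xi /\
    forall x, ccod psi x -> X (cinv psi x) = of_chart psi (cinv psi x) (xi x).

Hypothesis sX : smooth_field.
Hypothesis sW : smooth_fun W.

(** In a bundle chart [L] is half the quadratic form with coefficients [G i j] evaluated at [y], the
    fibre coordinate minus [xi], less [W]. *)
Lemma drift_smooth : smooth_TM L.
Proof.
move=> psi apsi n; have [xi [sxi xiE]] := sX apsi.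
pose P : set ('rV[R]_2 * 'rV[R]_2) := [set z | ccod psi z.1].
have oP : open P.
  apply: (@open_comp _ _ (fst : 'rV[R]_2 * 'rV[R]_2 -> 'rV[R]_2)); last exact: ccod_open.
  by move=> z _; exact: cvg_fst.
have Cfst : Ck n P (fst : 'rV[R]_2 * 'rV[R]_2 -> 'rV[R]_2).
  by apply: (@Ck_linear R ('rV[R]_2 * 'rV[R]_2)%type 'rV[R]_2 n P fst) => z; exact: cvg_fst.
have Csnd : Ck n P (snd : 'rV[R]_2 * 'rV[R]_2 -> 'rV[R]_2).
  by apply: (@Ck_linear R ('rV[R]_2 * 'rV[R]_2)%type 'rV[R]_2 n P snd) => z; exact: cvg_snd.
have base (f : 'rV[R]_2 -> R) : Ck n (ccod psi) f -> Ck n P (f \o fst).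
  by move=> Cf; apply: Ck_comp_rV Cf Cfst => //; exact: ccod_open.
pose y (z : 'rV[R]_2 * 'rV[R]_2) := z.2 - xi z.1.
have Cy i : Ck n P (fun z => y z 0 i).
  apply: (Ck_coord _ _ oP).1; apply: CkD => //.
  have := CkZ (-1) oP (Ck_comp_rV_rV oP (@ccod_open _ _ psi) (fun z Pz => Pz) (sxi n) Cfst).
  by apply: Ck_eq => // z _; rewrite /= scaleN1r.
pose G (i j : 'I_2) (x : 'rV[R]_2) := g (cinv psi x)
  (of_chart psi (cinv psi x) (e i)) (of_chart psi (cinv psi x) (e j)).
have CG i j : Ck n P (G i j \o fst).
  by apply: base; have [_ _ _ H] := hg; exact: H.
have CW := base _ (sW apsi n).
have Cyy i j := CkM oP (Cy i) (Cy j).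
have C1 := CkD oP (CkM oP (CG 0 0) (Cyy 0 0)) (CkD oP
  (CkZ 2 oP (CkM oP (CG 0 1) (Cyy 0 1))) (CkM oP (CG 1 1) (Cyy 1 1))).
have := CkD oP (CkZ 2^-1 oP C1) (CkZ (-1) oP CW).
apply: Ck_eq => // z; rewrite inE /P/= => Pz.
rewrite /in_chart /L xiE//; set q := cinv psi z.1.
have dq : cdom psi q by exact: cinv_dom.
rewrite -of_chartB// -/(y z) (metric_pullback hg) //.
  by rewrite /G -/q /GRing.scale/= mulN1r.
by move=> c u w; exact: of_chart_linear.
Qed.

Lemma drift_tonelli : tonelli L.
Proof.
split; [exact: drift_smooth| |exact: drift_superlinear].
by move=> q v w w0; rewrite dvvL_drift; exact: metric_gt0.
Qed.

End drift_lagrangian.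

(** * Submanifolds and tangent vectors *)

Lemma Ck_translation {R : realType} {V : normedModType R} n (c : V) :
  Ck n setT (fun x : V => x + c).
Proof.
apply: CkD; [exact: openT| |exact: Ck_cst].
by apply: (@Ck_linear _ _ _ _ _ idfun) => x; exact: cvg_id.
Qed.

Section translated_chart.
Context {R : realType} {M : surface R}.
Variables (phi : chart R M) (z0 : 'rV[R]_2).

Let shift_continuous (c : 'rV[R]_2) : continuous (fun x : 'rV[R]_2 => x + c).
Proof. by move=> x; exact: Ck_continuous (Ck_translation 0 c) I. Qed.

Let translated_ccod_open : open [set x | ccod phi (x + z0)].
Proof.
rewrite -[X in open X]/((fun x => x + z0) @^-1` ccod phi).
by apply: open_comp; [move=> x _; exact: shift_continuous|exact: ccod_open].
Qed.

(** Taking for [z0] the coordinates of a point gives a chart vanishing exactly there, which is the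
    slice chart of that point as a submanifold of dimension 0. *)
Definition translated_chart : chart R M.
Proof.
refine (@Chart R M (cdom phi) [set x | ccod phi (x + z0)] (fun q => cmap phi q - z0)
  (fun x => cinv phi (x + z0)) (@cdom_open _ _ phi) translated_ccod_open _ _ _ _ _ _).
- by move=> q dq; rewrite /= subrK; exact: cmap_cod.
- by move=> x; exact: cinv_dom.
- by move=> q dq; rewrite subrK cmapK.
- by move=> x cx; rewrite cinvK// addrK.
- by move=> q dq; apply: continuousB; [exact: cmap_continuous|exact: cst_continuous].
- move=> x cx; exact: continuous_comp (@shift_continuous z0 x) (cinv_continuous cx).
Defined.

Lemma translated_chart_maximal : atlas phi -> maximal_atlas translated_chart.
Proof.
move=> ap psi as_; split=> n.
  have oO : open (overlap translated_chart psi) := @overlap_open _ _ _ _.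
  have oO' := @overlap_open _ _ phi psi.
  have Cs : Ck n (overlap translated_chart psi) (fun x : 'rV[R]_2 => x + z0).
    exact: Ck_sub (@subsetT _ _) (Ck_translation n z0).
  by have := Ck_comp_rV_rV oO oO' (fun x Px => Px) (atlas_compat ap as_ n) Cs.
have oO := @overlap_open _ _ psi phi.
by have := CkD oO (atlas_compat as_ ap n) (Ck_cst n _ (- z0)).
Qed.

End translated_chart.

Section submanifolds.
Context {R : realType} {M : surface R}.

Lemma atlas_maximal (phi : chart R M) : atlas phi -> maximal_atlas phi.
Proof. by move=> ap psi as_; split; exact: atlas_compat. Qed.

Lemma set1_submanifold (q : M) : closed_connected_submanifold [set q].
Proof.
split; [|exact: compact_set1|exact: connected1|by exists q].
exists 0%N => // _ ->; exists (translated_chart (chart_at q) (cmap (chart_at q) q)).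
split.
- exact: translated_chart_maximal (chart_at_atlas q).
- exact: chart_at_dom.
move=> p dp; split=> [-> i _|H]; first by rewrite /= subrr mxE.
have E : cmap (chart_at q) p = cmap (chart_at q) q.
  by apply/subr0_eq/rowP => i; rewrite [RHS]mxE; exact: H.
have dp' : cdom (chart_at q) p := dp.
by rewrite /= -(cmapK dp') E cmapK//; exact: chart_at_dom.
Qed.

Lemma setT_submanifold (q : M) : compact [set: M] -> connected [set: M] ->
  closed_connected_submanifold [set: M].
Proof.
move=> cM kM; split=> //; last by exists q.
exists 2%N => // p _; exists (chart_at p); split.
- exact/atlas_maximal/chart_at_atlas.
- exact: chart_at_dom.
by move=> p' _; split=> // _ i; rewrite leqNgt ltn_ord.
Qed.

Lemma tangent_set1 (x q : M) v : tangent [set x] q v -> v = 0.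
Proof.
move=> [I [c [[oI I0] _ Ic c0 <-]]]; rewrite /velocity derive1E.
rewrite -[RHS](derive_cst (cmap (chart_at (c 0)) x) (0 : R) 1); apply: near_eq_derive.
have : \forall t \near (0 : R), I t by apply: open_nbhs_nbhs.
by apply: filterS => t /Ic/= ->.
Qed.

Lemma line_continuous (z w : 'rV[R]_2) : continuous (fun t : R => z + t *: w).
Proof. by move=> t; apply: cvgD; [exact: cvg_cst|exact: scalel_continuous]. Qed.

(** The curve realising [w] is a coordinate line in the preferred chart of [q]. *)
Lemma tangent_setT (q : M) w : tangent [set: M] q w.
Proof.
pose phi := chart_at q; pose z := cmap phi q; pose l (t : R) : 'rV[R]_2 := z + t *: w.
have dq : cdom phi q := chart_at_dom q.
have l0 : l 0 = z by rewrite /l scale0r addr0.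
have lin : linear (fun t : R => t *: w) by move=> a s t; rewrite scalerDl scalerA.
pose linM := GRing.isLinear.Build _ _ _ _ _ lin.
pose linL : {linear R -> 'rV[R]_2} := HB.pack (fun t : R => t *: w) linM.
have cl : continuous l by exact: line_continuous.
pose I := [set t : R | ccod phi (l t)].
have oI : open I by rewrite -[I]/(l @^-1` ccod phi); apply: open_comp => [t _|]; [exact: cl|exact: ccod_open].
have I0 : I 0 by rewrite /I/= l0; exact: cmap_cod.
have c0 : cinv phi (l 0) = q by rewrite l0 cmapK.
exists I, (cinv phi \o l); split=> //.
- move=> n; split=> [t It|psi apsi].
    exact: continuous_comp (cl t) (cinv_continuous It).
  have oO := @overlap_open _ _ phi psi.
  have -> : I `&` (cinv phi \o l) @^-1` cdom psi = l @^-1` overlap phi psi by [].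
  have oU : open (l @^-1` overlap phi psi) by apply: open_comp => [t _|//]; exact: cl.
  have C : Ck n (l @^-1` overlap phi psi) l.
    apply: CkD => //; first exact: Ck_cst.
    by apply: (@Ck_linear _ _ _ _ _ linL); exact: scalel_continuous.
  by have := Ck_comp_rV_rV oU oO (fun x Px => Px) (atlas_compat (chart_at_atlas q) apsi n) C.
(* The curve starts at [q], whose preferred chart is [phi], so the velocity is the derivative of the
   coordinate line [l]. *)
rewrite /velocity derive1E [(_ \o l) 0]c0.
have dl : 'D_(1 : R) l 0 = w.
  have dlin : differentiable linL (0 : R).
    by apply: linear_differentiable; exact: scalel_continuous.
  rewrite -[l]/(cst z + linL) deriveD//; last exact: diff_derivable.
  by rewrite derive_cst add0r deriveE// diff_lin//= ?scale1r//; exact: scalel_continuous.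
rewrite -dl; apply: near_eq_derive.
have : \forall t \near (0 : R), I t by exact: open_nbhs_nbhs.
by apply: filterS => t It; rewrite /= cinvK.
Qed.

End submanifolds.

(** * The example *)

Section smooth_constructions.
Context {R : realType} {M : surface R}.

Lemma smooth_fun_quadratic (b : M -> R) (c2 c1 c0 : R) : smooth_fun b ->
  smooth_fun (fun q => c2 * b q ^+ 2 + c1 * b q + c0).
Proof.
move=> sb psi apsi n; have Cb := sb psi apsi n.
have oO := @ccod_open _ _ psi.
have := CkD oO (CkD oO (CkZ c2 oO (CkM oO Cb Cb)) (CkZ c1 oO Cb)) (Ck_cst n _ c0).
by apply: Ck_eq => // x _; rewrite /= expr2.
Qed.

(** A multiple of a constant coordinate field of one chart, extended by zero. *)
Lemma smooth_chart_field (phi : chart R M) (eta : M -> R) (u : 'rV[R]_2) :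
  atlas phi -> smooth_fun eta ->
  (forall q, ~ cdom phi q -> \forall p \near q, eta p = 0) ->
  smooth_field (fun q => of_chart phi q (eta q *: u)).
Proof.
move=> ap seta eta0 psi as_.
(* The vector [u] is pushed forward to [psi] by the derivative of the transition map; the factor
   [eta] vanishes where this has no meaning. *)
exists (fun x => eta (cinv psi x) *: 'D_u (transition phi psi) (transition psi phi x)).
split=> [n|x cx]; last first.
  have [dx|/eta0/nbhs_singleton->] := pselect (cdom phi (cinv psi x)); last first.
    by rewrite !scale0r !of_chart0.
  have dpx : cdom psi (cinv psi x) := cinv_dom cx.
  have Z (chi : chart R M) (c : R) v : atlas chi -> cdom chi (cinv psi x) ->
      of_chart chi (cinv psi x) (c *: v) = c *: of_chart chi (cinv psi x) v.
    by move=> ac dc; rewrite -[c *: v]addr0 of_chart_linear// of_chart0 addr0.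
  by rewrite !Z// [transition psi phi x]/(cmap phi (cinv psi x)) of_chart_trans.
apply: Ck_local => x cx; have [dx|dx] := pselect (cdom phi (cinv psi x)).
  exists (overlap psi phi); first by [].
  have oO := @overlap_open _ _ psi phi.
  have Ceta : Ck n (overlap psi phi) (eta \o cinv psi).
    by apply: Ck_sub (seta psi as_ n) => y [].
  have CD := Ck_comp_rV_rV oO (@overlap_open _ _ phi psi)
    (@overlap_transition _ _ psi phi) (Ck_derive u (atlas_compat ap as_ n.+1))
    (atlas_compat as_ ap n).
  apply/Ck_coord => // i.
  have := CkM oO Ceta ((Ck_coord _ _ oO).1 CD i).
  by apply: Ck_eq => // y _; rewrite /= mxE.
have nx := near_cinv cx (eta0 _ dx).
exists (interior [set y | eta (cinv psi y) = 0]); first exact: nx.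
apply: Ck_eq (Ck_cst _ _ 0); first exact: open_interior.
by move=> y; rewrite inE => /interior_subset /= ->; rewrite scale0r.
Qed.

End smooth_constructions.

Section bounds.
Context {R : realType} {M : surface R}.
Variables (L : M -> 'rV[R]_2 -> R).

(* No boundedness is needed: sup is 0 on sets without a supremum. *)
Lemma hamiltonian_ge0 q (p : 'rV[R]_2 -> R) : p 0 = 0 -> L q 0 = 0 ->
  0 <= hamiltonian L q p.
Proof.
move=> p0 L0; pose A := range (fun v => p v - L q v).
rewrite -[hamiltonian L q p]/(sup A).
have A0 : A 0 by exists 0 => //; rewrite p0 L0 subr0.
have [/sup_upper_bound/(_ _ A0)//|/sup_out->//] := pselect (has_sup A).
Qed.

(** One point of the cover, the class of [c], bounds the supremum below for every [u]: the vector 0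
    contributes -L(c 1, 0) = 0 to the Legendre transform. *)
Lemma mane_value_ge0 (x0 : M) (Q0 Q1 : set M) (c : R -> M) :
  based_path x0 c -> L (c 1) 0 = 0 -> (0 <= mane_value x0 L Q0 Q1)%E.
Proof.
move=> bc L0; apply: le_ereal_inf_tmp => _ [u _ <-].
apply: (@le_trans _ _ (hamiltonian L (c 1) (dcover u c))%:E); last first.
  by apply: ereal_sup_ubound; exists c.
by rewrite lee_fin hamiltonian_ge0// /dcover derive0.
Qed.

End bounds.

Section isolated_point.
Context {R : realType} {M : surface R}.

Lemma component_set1 (x : M) : component [set x] = [set [set x]].
Proof.
have E : connected_component [set x] x = [set x].
  apply/seteqP; split; first exact: connected_component_sub.
  by move=> _ ->; exact: connected_component_refl.
by rewrite /component image_set1 E.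
Qed.

(** There is a single component, hence a single isolating family, and the infimum and both suprema
    are over singletons. *)
Lemma k_Omega_set1 (x0 : M) g (L : M -> 'rV[R]_2 -> R) (a : R) (Q0 Q1 : set M) (x : M) :
  Q0 `&` Q1 = [set x] ->
  k_Omega x0 g L a Q0 Q1 [set x] =
  Order.min (mane_value x0 L Q0 Q1)
    (energy L x 0 + dual_norm g x (theta L x) ^+ 2 / (4 * a))%:E.
Proof.
move=> Qx; rewrite /k_Omega (_ : isolating_family _ _ _ _ = [set [set [set x]]]).
  by rewrite image_set1 ereal_inf1 /k_nu bigcup_set1 !image_set1 !ereal_sup1.
rewrite /isolating_family Qx component_set1; apply/seteqP; split=> [nu|_ ->] /=.
  move=> [sub nx _]; apply/seteqP; split=> // _ ->; exact: nx.
by split=> //; exists 1 => // Z ->.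
Qed.

End isolated_point.

Section no_connecting_orbit.
Context {R : realType} {M : surface R}.
Variables (g : M -> 'rV[R]_2 -> 'rV[R]_2 -> R) (X : M -> 'rV[R]_2) (W b : M -> R).
Hypothesis hg : riemannian_metric g.
Hypothesis cb : continuous b.

(** Conormality to the whole surface makes the initial velocity [X], so k = W(c 0) and b(c 0) < v.
    Before reaching [x0] the orbit meets {b = v}, where X = 0 and the energy is at least W > k. *)
Lemma no_connecting_orbit (x0 : M) (v k : R) :
  v < b x0 ->
  (forall q, v <= b q -> k < W q) ->
  (forall q, b q = v -> X q = 0) ->
  ~ exists (T : R) (c : R -> M),
    connecting_orbit (drift_lagrangian g X W) [set: M] [set x0] T c /\
    has_energy (drift_lagrangian g X W) k T c.
Proof.
move=> vx0 kW X0 [T [c [[T0 [[I [oI TI [cI _]]] _] [_ cT] conormal0 _] Ek]]].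
have cbc t : 0 <= t <= T -> {for t, continuous (b \o c)}.
  by move=> tT; apply: continuous_comp; [exact/cI/TI|exact: cb].
have vel : velocity c 0 = X (c 0).
  (* The conormal condition is tested on the momentum vector [velocity c 0 - X (c 0)] itself, whose
     square is thus 0. *)
  apply/eqP; rewrite -subr_eq0; apply: contraT => /(metric_gt0 hg (c 0)).
  have := conormal0 (velocity c 0 - X (c 0)) (tangent_setT _ _).
  by rewrite dvL_drift// => ->; rewrite ltxx.
have k0 : k = W (c 0).
  by rewrite -(Ek 0) ?lexx ?ltW// energy_drift// vel; ring.
have [b0|b0] := leP v (b (c 0)); first by have := kW _ b0; rewrite k0 ltxx.
have [t] : exists2 t, t \in `[0, T] & (b \o c) t = v.
  apply: IVT; [exact: ltW| |].
    by apply: continuous_in_subspaceT => t; rewrite inE/= in_itv/=; exact: cbc.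
  by rewrite /= cT ge_min le_max (ltW b0) (ltW vx0) orbT.
rewrite in_itv/= => tT bt; have := kW (c t); rewrite bt lexx => /(_ isT).
rewrite -(Ek t tT) energy_drift// X0// ltNge => /negP; apply.
rewrite (_ : g (c t) 0 0 = 0); last by rewrite metricE// !mxE; ring.
by rewrite mulr0 subr0 lerDr mulr_ge0// metric_ge0.
Qed.

End no_connecting_orbit.

Unset Implicit Arguments.
Set Strict Implicit.

Theorem theorem4 (R : realType) (Sigma : surface R) (x0 : Sigma)
    (hSigma : closed_connected_orientable Sigma) :
  exists (g : Sigma -> 'rV[R]_2 -> 'rV[R]_2 -> R)
         (L : Sigma -> 'rV[R]_2 -> R) (a : R) (Q0 Q1 : set Sigma),
    [/\ riemannian_metric g, tonelli L, admissible g L a,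
        [/\ closed_connected_submanifold Q0, closed_connected_submanifold Q1 &
            Q0 `&` Q1 !=set0] &
        forall Omega : set Sigma, component (Q0 `&` Q1) Omega ->
          [/\ (k_conormal L Q0 Q1 < k_Omega x0 g L a Q0 Q1 Omega)%E,
              (k_Omega x0 g L a Q0 Q1 Omega < mane_value x0 L Q0 Q1)%E &
              forall k : R, (k%:E < k_Omega x0 g L a Q0 Q1 Omega)%E ->
                ~ exists (T : R) (c : R -> Sigma),
                    connecting_orbit L Q0 Q1 T c /\ has_energy L k T c]].
Proof.
have [cS kS _] := hSigma.
have [g hg] := riemannian_metric_exists x0 cS.
pose phi := chart_at x0; pose z0 := cmap phi x0.
have aphi : atlas phi := chart_at_atlas x0.
have dx0 : cdom phi x0 := chart_at_dom x0.
have [r r0 subr] := ccod_radius (cmap_cod dx0).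
pose b := chart_bump z0 r phi.
have sb : smooth_fun b := smooth_bump r0 aphi subr.
have b0 q : ~ cdom phi q -> \forall p \near q, b p = 0 := chart_bump_near0 r0 subr (q := q).
have bx0 : b x0 = 1 by rewrite /b chart_bump_in// radial_bump_center.
pose e0 : 'rV[R]_2 := delta_mx 0 0.
(* Since b(x0) = 1, eta(x0) = lam / 2, and lam is chosen to make lam^2 / 4 times the coefficient
   equal to 2. *)
pose lam := Num.sqrt (8 / metric_coef g x0 0 0).
(* Both [eta] and [W] are expanded to fit [smooth_fun_quadratic]; [etaE] and [WE] give the factored
   forms. *)
pose eta q := lam * b q ^+ 2 + (- (lam / 2)) * b q + 0.
pose X q := of_chart phi q (eta q *: e0).
pose W q := -6 * b q ^+ 2 + 7 * b q + (- 2).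
pose L := drift_lagrangian g X W.
have etaE q : eta q = lam * b q * (b q - 2^-1) by rewrite /eta; field.
have WE q : W q = - ((2 * b q - 1) * (3 * b q - 2)) by rewrite /W; ring.
have sX : smooth_field X.
  apply: smooth_chart_field => //; first exact: smooth_fun_quadratic.
  by move=> q /b0; apply: filterS => p bp; rewrite etaE bp; ring.
have sW : smooth_fun W by exact: smooth_fun_quadratic.
have X0 q : eta q = 0 -> X q = 0 by rewrite /X => ->; rewrite scale0r of_chart0.
have XX : g x0 (X x0) (X x0) = 2.
  have c0 := metric_coef_gt0 hg x0 0.
  have lam2 : lam ^+ 2 = 8 / metric_coef g x0 0 0.
    by rewrite sqr_sqrtr// divr_ge0// ltW.
  rewrite [X x0]of_chart_at etaE bx0 metricE// !mxE/=.
  transitivity (lam ^+ 2 * metric_coef g x0 0 0 / 4); first by field.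
  by rewrite lam2; field; rewrite gt_eqF.
have Wx0 : W x0 = -1 by rewrite WE bx0; ring.
(* A radial segment from [x0] to the edge of the bump. Along it [b] goes from 1 to 0, which supplies
   points with b = 0 and, by the intermediate value theorem, with b = 1/2. *)
pose l (t : R) := cinv phi (z0 + t *: e0).
have ccodl t : 0 <= t <= r -> ccod phi (z0 + t *: e0).
  move=> /andP[t0 tr]; apply: subr => i.
  have E : (z0 + t *: e0) 0 i - z0 0 i = t * e0 0 i by rewrite !mxE; ring.
  rewrite -[X in `|X|]/((z0 + t *: e0) 0 i - z0 0 i) E normrM ger0_norm//.
  by rewrite mxE; case: (_ && _); rewrite ?(normr1, normr0) ?(mulr1, mulr0)// ltW.
have cl t : 0 <= t <= r -> {for t, continuous l}.
  move=> /ccodl ct; apply: continuous_comp; first exact: line_continuous.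
  exact: cinv_continuous.
have bl t : 0 <= t <= r -> b (l t) = radial_bump z0 r (z0 + t *: e0).
  by move=> /ccodl ct; rewrite /b chart_bump_in ?cinvK//; exact: cinv_dom.
have l0 : l 0 = x0 by rewrite /l scale0r addr0 cmapK.
have rr : 0 <= r <= r by rewrite lexx ltW.
have blr : b (l r) = 0.
  have sq : sqnorm (z0 + r *: e0 - z0) = r ^+ 2.
    rewrite [z0 + _]addrC addrK sqnormZ /sqnorm big_ord2 !mxE/=.
    by rewrite expr1n expr0n addr0 mulr1.
  by rewrite bl// /radial_bump sq subrr flat_le0 ?mul0r.
have [t tr blt] : exists2 t, t \in `[0, r] & (b \o l) t = 2^-1.
  apply: IVT; [exact: ltW| |].
    apply: continuous_in_subspaceT => t; rewrite inE/= in_itv/= => tr.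
    by apply: continuous_comp; [exact: cl|exact: smooth_fun_continuous].
  rewrite /= l0 bx0 blr ge_min le_max invr_ge0 ler0n orbT/=.
  by rewrite invf_le1// ler1n.
rewrite in_itv/= in tr.
have etal : eta (l t) = 0 by rewrite etaE [b _]blt; ring.
(* At [l t] both [X] and [W] vanish, so L(l t, 0) = 0; the segment rescaled to [0, 1] is a based
   path ending there. *)
have mane : (0 <= mane_value x0 L [set: Sigma] [set x0])%E.
  apply: (@mane_value_ge0 _ _ _ _ _ _ (fun s => l (s * t))).
    split; rewrite ?mul0r ?mul1r//.
    apply: continuous_in_subspaceT => s; rewrite inE/= in_itv/= => /andP[s0 s1].
    have str : 0 <= s * t <= r.
      by case/andP: tr => t0 tr; rewrite mulr_ge0//= (le_trans _ tr)// ler_piMl.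
    have cm : {for s, continuous (fun s : R => s * t)}.
      exact: (@scalel_continuous _ R^o t s).
    exact: continuous_comp cm (cl _ str).
  rewrite mul1r /L /drift_lagrangian X0// WE [b _]blt subr0 metricE// !mxE.
  by field.
(* E(x0, 0) = -|X|^2 / 2 + W = -2, and the theta term is |X|^2 / (4 a) = 1; their sum -1 lies below
   c >= 0. *)
have kO : k_Omega x0 g L 2^-1 [set: Sigma] [set x0] [set x0] = (-1)%:E.
  rewrite (@k_Omega_set1 _ _ _ _ _ _ _ _ x0) ?setTI//.
  rewrite dual_theta_drift// energy_drift// Wx0 XX.
  rewrite (_ : _ + _ / _ = -1); last by rewrite metricE// !mxE; field.
  by apply/min_idPr; apply: le_trans mane; rewrite lee_fin lerN10.
exists g, L, 2^-1, [set: Sigma], [set x0]; split=> //.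
- exact: drift_tonelli.
- exact: drift_admissible.
- split; [exact: setT_submanifold|exact: set1_submanifold|].
  by rewrite setTI; exists x0.
rewrite setTI component_set1 => _ ->; rewrite kO; split.
- apply: (@le_lt_trans _ _ (-2)%:E); last by rewrite lte_fin; lra.
  apply: ereal_inf_lbound; exists (-2) => //; split.
    (* On the whole surface only the momentum 0 is conormal, and W = -2 where b = 0. *)
    exists (l r), (\0 : {scalar 'rV[R]_2}); split=> //.
    transitivity (W (l r)); first exact: hamiltonian_drift0.
    by rewrite WE blr; ring.
  (* At the point [x0] every covector is conormal; the one dual to -X minimises H on the fibre, with
     value -|X|^2 / 2 + W = -2. *)
  have plin : scalar (g x0 (- X x0)) by move=> c u v; have [gl _ _ _] := hg; exact: gl.
  pose pM := GRing.isLinear.Build _ _ _ _ _ plin.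
  pose p : {scalar 'rV[R]_2} := HB.pack (g x0 (- X x0)) pM.
  exists x0, p; split=> // [v /tangent_set1 ->|]; first exact: linear0.
  transitivity (- 2^-1 * g x0 (X x0) (X x0) + W x0).
    apply: etrans (hamiltonian_drift X W hg x0 (- X x0)) _.
    rewrite (metricE hg _ (X x0) (- X x0)) (metricE hg _ (- X x0)).
    by rewrite (metricE hg _ (X x0) (X x0)) !mxE; field.
  by rewrite XX Wx0; field.
- by apply: lt_le_trans mane; rewrite lte_fin ltrN10.
move=> k; rewrite lte_fin => k1.
apply: (@no_connecting_orbit _ _ _ X W b hg _ x0 2^-1 k).
- exact: smooth_fun_continuous.
- by rewrite bx0; lra.
- move=> q bq; apply: lt_le_trans k1 _; have b1 := chart_bump_le1 z0 r0 phi q.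
  (* This factorisation shows W >= -1 for 1/2 <= b <= 1. *)
  rewrite WE -subr_ge0 (_ : _ - -1 = (1 - b q) * (6 * b q - 1)); last by ring.
  by rewrite mulr_ge0// subr_ge0//; lra.
by move=> q bq; apply: X0; rewrite etaE bq; ring.
Qed.
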